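(* Let $f:\mathbb R\to\mathbb C$ be a continuous function with $f(0)=1$ and $f(t)\neq 0$ for all $t\in\mathbb R$, and let $\psi(t,h)=\mathrm{Ln} f(t)-\frac12\bigl(\mathrm{Ln} f(t-h)+\mathrm{Ln} f(t+h)\bigr)$, $t,h\in\mathbb R$. Suppose that $$\psi(t,h)=I(t,h)+\delta(t,h)\quad\text{for any } t\geqslant 0,\ h>0,$$ where the function $I$ admits the representation $$I(t,h)=\int_{\mathbb R} e^{itx}\bigl(1-\cos(hx)\bigr)\tfrac{1+x^2}{x^2}\,dG(x)\quad\text{for any } t\geqslant 0,\ h>0,$$ with some $G\in\boldsymbol V$, and the function $\delta$ satisfies $$\sum_{k=0}^{n_{t,l}-1}(n_{t,l}-k)\,|\delta(kh_l,h_l)|\to 0,\quad l\to\infty,\quad\text{for any } t>0,$$ where $(h_l)_{l\in\mathbb N}$ is a fixed sequence of positive reals with $h_l\to 0$ as $l\to\infty$, and $n_{t,l}=\lfloor t/h_l\rfloor$ for $t>0$, $l\in\mathbb N$. Then, with this function $G$ and with $\gamma=\mathrm{Arg} f(1)$, $$f(t)=\exp\biggl\{it\gamma+\int_{\mathbb R}\bigl(e^{itx}-1-it\sin(x)\bigr)\tfrac{1+x^2}{x^2}\,dG(x)\biggr\},\quad t\in\mathbb R.$$ If it is additionally known that $f$ is the characteristic function of some distribution function $F$, then $F\in\boldsymbol Q$.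
   Context: For continuous $f:\mathbb R\to\mathbb C$ with $f(0)=1$ and $f(t)\ne0$ for all $t$, the distinguished logarithm is $\mathrm{Ln} f(t)=\ln|f(t)|+i\,\mathrm{Arg} f(t)$, $t\in\mathbb R$, where $\mathrm{Arg} f$ is the unique continuous argument of $f$ on $\mathbb R$ with $\mathrm{Arg} f(0)=0$. $\boldsymbol V$ is the class of all functions $G:\mathbb R\to\mathbb R$ of bounded variation on $\mathbb R$ that are right-continuous at every point and satisfy $G(-\infty)=0$. Integrals with respect to $dG$ are Lebesgue–Stieltjes integrals. At $x=0$ the integrands are defined by continuity: $\bigl(1-\cos(hx)\bigr)\frac{1+x^2}{x^2}\big|_{x=0}=\frac{h^2}{2}$ and $\bigl(e^{itx}-1-it\sin(x)\bigr)\frac{1+x^2}{x^2}\big|_{x=0}=-\frac{t^2}{2}$. The characteristic function of a distribution function $F$ on $\mathbb R$ is $f(t)=\int_{\mathbb R}e^{itx}\,dF(x)$. $F$ is infinitely divisible if for every positive integer $n$ there is a distribution function $F_{1/n}$ whose $n$-fold convolution power is $F$. $\boldsymbol Q$ is the class of rational-infinitely divisible distribution functions, i.e. distribution functions $F$ for which there exist infinitely divisible distribution functions $F_1,F_2$ with $F_1=F*F_2$ (convolution). $\lfloor\cdot\rfloor$ is the floor function; empty sums ($\sum_{j=n}^{m}$ with $n>m$) equal $0$.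
   Formalization: The formula for f is claimed only under the added hypothesis f(−t) = conjugate of f(t) for all t; without it the claim fails (f(t)=e^t with G=0, δ=0), and the formula itself forces this symmetry. The assertion F∈Q needs no added hypothesis. *)

(* Defs.v *)
From HB Require Import structures.
From mathcomp Require Import all_boot all_order all_algebra.
From mathcomp Require Import complex.
From mathcomp Require Import all_classical all_reals all_analysis.

Set Implicit Arguments.
Unset Strict Implicit.
Unset Printing Implicit Defensive.

Import Order.TTheory GRing.Theory Num.Theory.
Import numFieldNormedType.Exports.

Local Open Scope classical_set_scope.
Local Open Scope ring_scope.
Local Open Scope complex_scope.

Section ComplexFunctions.
Context {R : realType}.
Implicit Types (f : R -> R[i]) (t h x : R).

Definition modulus (z : R[i]) : R := ComplexField.Normc.normc z.

Definition expC (z : R[i]) : R[i] :=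
  (expR (complex.Re z))%:C * (cos (complex.Im z) +i* sin (complex.Im z)).

Definition is_Arg f (A : R -> R) : Prop :=
  [/\ continuous A, A 0 = 0 &
      forall t, f t = (modulus (f t))%:C * expC (0 +i* A t)].

(* [is_Arg f] has exactly one inhabitant when f is continuous and nowhere zero
   with f 0 = 1, so [get] is a definite description there. *)
Definition Arg f : R -> R := get (is_Arg f).

Definition Ln f t : R[i] := ln (modulus (f t)) +i* Arg f t.

Definition psi f t h : R[i] :=
  Ln f t - 2^-1 * (Ln f (t - h) + Ln f (t + h)).

End ComplexFunctions.

Section Variation.
Context {R : realType}.
Implicit Types (G : R -> R) (a b x y : R).

Definition finite_BV G : Prop :=
  exists M : R, forall a b : R, a <= b -> (total_variation a b G <= M%:E)%E.

(* Total variation of G over ]-oo, x]. *)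
Definition variationNy G x : R :=
  fine (ereal_sup [set total_variation a x G | a in [set a | a <= x]]).

Definition negative_variation G x : R := (variationNy G x - G x) / 2.
Definition positive_variation G x : R := (variationNy G x + G x) / 2.

Lemma finite_BV_fin G a b : finite_BV G -> a <= b ->
  total_variation a b G \is a fin_num.
Proof.
move=> [M HM] ab; rewrite ge0_fin_numE ?total_variation_ge0//.
by rewrite (le_lt_trans (HM _ _ ab))// ltry.
Qed.

Lemma variationNy_fin G x : finite_BV G ->
  ereal_sup [set total_variation a x G | a in [set a | a <= x]] \is a fin_num.
Proof.
move=> [M HM]; rewrite ge0_fin_numE.
  apply: (@le_lt_trans _ _ M%:E); last exact: ltry.
  by apply: ge_ereal_sup => _ [a /= ax <-]; exact: HM.
by apply: ereal_sup_ubound; exists x => //=; rewrite total_variationxx.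
Qed.

Lemma variationNyD G x y : finite_BV G -> x <= y ->
  variationNy G y = variationNy G x + fine (total_variation x y G).
Proof.
move=> BVG xy; rewrite /variationNy -fineD ?variationNy_fin ?finite_BV_fin//.
congr fine; apply/le_anti/andP; split.
  apply: ge_ereal_sup => _ [a /= ay <-].
  have [ax|/ltW xa] := leP a x.
    by rewrite (total_variationD G ax xy) leeD2r//; apply: ereal_sup_ubound; exists a.
  apply: (@le_trans _ _ (total_variation x y G)).
    by rewrite (total_variationD G xa ay) leeDr// total_variation_ge0.
  by rewrite leeDr//; apply: ereal_sup_ubound; exists x => //=;
     rewrite total_variationxx.
rewrite -leeBrDr ?finite_BV_fin//; apply: ge_ereal_sup => _ [a /= ax <-].
rewrite leeBrDr ?finite_BV_fin// -(total_variationD G ax xy).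
by apply: ereal_sup_ubound; exists a => //=; exact: le_trans xy.
Qed.

Lemma negative_variationE G x y : finite_BV G -> x <= y ->
  negative_variation G y = variationNy G x / 2 + fine (neg_tv x G y).
Proof.
move=> BVG xy; rewrite /negative_variation (variationNyD BVG xy) /neg_tv.
rewrite fineM ?fin_numB ?finite_BV_fin// fineB ?finite_BV_fin//.
by rewrite -addrA mulrDl.
Qed.

Lemma finite_BV_bounded G a b : finite_BV G -> a <= b -> bounded_variation a b G.
Proof. by move=> BVG ab; apply/bounded_variationP => //; exact: finite_BV_fin. Qed.

Lemma negative_variation_nd G : finite_BV G -> nondecreasing (negative_variation G).
Proof.
move=> BVG x y xy; rewrite (negative_variationE BVG (lexx x)).
rewrite (negative_variationE BVG xy) lerD2l.
apply: (fine_neg_tv_nondecreasing (finite_BV_bounded BVG xy)) => //;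
by rewrite in_itv/= ?lexx ?xy.
Qed.

Lemma negative_variation_rc G : finite_BV G -> right_continuous G ->
  right_continuous (negative_variation G).
Proof.
move=> BVG rcG x; rewrite (negative_variationE BVG (lexx x)).
have x1 : x < x + 1 by rewrite ltrDl.
have := @neg_tv_right_continuous _ x x _ G (lexx x) x1
  (finite_BV_bounded BVG (ltW x1)) (rcG x).
move=> /(cvgD (cvg_cst (variationNy G x / 2))).
apply: cvg_trans; apply: near_eq_cvg; near=> y.
by rewrite (@negative_variationE G x y)//.
Unshelve. all: by end_near. Qed.

Lemma finite_BVN G : finite_BV G -> finite_BV (\- G).
Proof. by move=> [M HM]; exists M => a b /HM; rewrite total_variationN. Qed.

Lemma positive_variationE G : positive_variation G = negative_variation (\- G).
Proof.
apply/funext => x; rewrite /positive_variation /negative_variation /= opprK.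
congr ((fine (ereal_sup _) + _) / _); apply: eq_imagel => a _.
by rewrite total_variationN.
Qed.

End Variation.

Record classV (R : realType) := ClassV {
  V_fun :> R -> R;
  V_finite_BV : finite_BV V_fun;
  V_right_continuous : right_continuous V_fun;
  V_cvgNy : V_fun x @[x --> -oo] --> (0 : R) }.

Section LebesgueStieltjesIntegral.
Context {R : realType}.
Implicit Type G : classV R.

HB.instance Definition _ G :=
  isCumulative.Build R _ R (negative_variation G)
    (negative_variation_nd (V_finite_BV G))
    (negative_variation_rc (V_finite_BV G) (@V_right_continuous _ G)).

Lemma V_positive_variation_nd G : nondecreasing (positive_variation G).
Proof.
rewrite positive_variationE; apply: negative_variation_nd.
exact: finite_BVN (V_finite_BV G).
Qed.

Lemma V_positive_variation_rc G : right_continuous (positive_variation G).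
Proof.
rewrite positive_variationE; apply: negative_variation_rc.
  exact: finite_BVN (V_finite_BV G).
by move=> x; apply: cvgN; exact: V_right_continuous.
Qed.

HB.instance Definition _ G :=
  isCumulative.Build R _ R (positive_variation G)
    (@V_positive_variation_nd G) (@V_positive_variation_rc G).

Definition integralC (mu : {measure set (measurableTypeR R) -> \bar R})
    (g : R -> R[i]) : R[i] :=
  (\int[mu]_x complex.Re (g x)) +i* (\int[mu]_x complex.Im (g x)).

(* The signed Lebesgue-Stieltjes measure dG is the difference of the measures of
   the positive and negative variations of G, which are both finite. *)
Definition LS_integral G (g : R -> R[i]) : R[i] :=
  integralC (lebesgue_stieltjes_measure (positive_variation G)) g -
  integralC (lebesgue_stieltjes_measure (negative_variation G)) g.

End LebesgueStieltjesIntegral.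

Section Integrands.
Context {R : realType}.
Implicit Types t h x : R.

Definition cos_integrand t h x : R[i] :=
  expC (0 +i* (t * x)) *
  (if x == 0 then h ^+ 2 / 2
   else (1 - cos (h * x)) * ((1 + x ^+ 2) / x ^+ 2))%:C.

Definition sin_integrand t x : R[i] :=
  if x == 0 then (- (t ^+ 2 / 2))%:C
  else (expC (0 +i* (t * x)) - 1 - (0 +i* (t * sin x))) *
       ((1 + x ^+ 2) / x ^+ 2)%:C.

End Integrands.

Notation distribution_function R := (cumulativeBounded (0 : R) (1 : R)).

Section DistributionFunctions.
Context {R : realType}.
Implicit Types F : distribution_function R.

Definition charfun F (t : R) : R[i] :=
  integralC (lebesgue_stieltjes_measure F) (fun x => expC (0 +i* (t * x))).

Definition convolution (H : R -> R) F (x : R) : R :=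
  \int[lebesgue_stieltjes_measure F]_y H (x - y).

(* The convolution power of F with n.+1 factors. *)
Definition convolution_powS F (n : nat) : R -> R :=
  iter n (fun H => convolution H F) F.

Definition infinitely_divisible F : Prop :=
  forall n : nat, exists Fn : distribution_function R,
    forall x, F x = convolution_powS Fn n x.

Definition classQ F : Prop :=
  exists F1 F2 : distribution_function R,
    [/\ infinitely_divisible F1, infinitely_divisible F2 &
        forall x, F1 x = convolution F F2 x].

End DistributionFunctions.

(* Main.v *)
Require Import Defs.
From HB Require Import structures.
From mathcomp Require Import all_boot all_order all_algebra.
From mathcomp Require Import complex.
From mathcomp Require Import all_classical all_reals all_analysis.
From mathcomp Require Import measurable_realfun ring lra.

(** Let E(t) be the integral of the sine integrand against dG. Pointwise in x,
the cosine integrand is the half second difference in t of the sine integrand,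
so the hypothesis on psi says that D = Ln f - E satisfies
D(t) - (D(t-h) + D(t+h))/2 = delta(t,h) for t >= 0. As D(0) = 0, summation by
parts twice expresses D(n h) - n D(h) through the values delta(k h, h),
1 <= k < n, with weights -2 (n - k) ([second_difference_bound]). Along h = h_l and
n = floor(t/h_l) this sum vanishes in the limit, and continuity of D makes D
linear on the half-line ([linear_limit]). When f is Hermitian, the real part of
D is even, the term k = 0 of the sum controls D(h) itself, and the real part
vanishes ([vanishing_limit]). The imaginary part of E(1) is zero, so the slope
of the imaginary part of D is Arg f(1). Negative t follow by conjugation. All
this uses that Ln f is continuous, hence that a continuous argument exists; it
is built by adding up the small angles between successive points of the curve
f/|f| ([argument_exists]).

If f is the characteristic function of F, then f is Hermitian and has the
representation just obtained. Split dG into the finite measures K+ and K- of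
the positive and negative variations. For a finite measure K, the exponential
of a drift plus the kernel integral over K is a characteristic function
([levy_khintchine_charfun]): when K is discretised the exponent becomes that of
a compound Poisson law, Poisson laws are limits of powers of two-point laws,
and limits are taken with the continuity theorem ([levy_continuity]). Applied to
K/n, this gives n-th roots, so the laws F1 of K+ and F2 of K- are infinitely
divisible. The characteristic functions satisfy f1 = f f2, and the uniqueness
theorem ([charfun_inj]) turns this into F1 = F * F2.

Uniqueness and continuity both rest on one identity ([cauchy_transform]): the
integral of Re (e^{-i s u r} f(s r)) against the exponential density in r is
the integral of the Cauchy kernel 1/(1 + s^2 (x-u)^2) against dF(x). At u = 0
this positive kernel controls the tails of F, which gives tightness; integrated
in u it becomes atan (s (u - x)), which tends to a step function as s grows,
and this gives uniqueness. *)

Set Implicit Arguments.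
Unset Strict Implicit.
Unset Printing Implicit Defensive.

Import Order.TTheory GRing.Theory Num.Theory.
Import numFieldNormedType.Exports.

Local Open Scope classical_set_scope.
Local Open Scope ring_scope.
Local Open Scope complex_scope.

(* Comparing two trigonometric terms by unfolding their power series is
hopelessly long. *)
#[local] Opaque cos sin expR atan.


(** * Integration on finite measures *)

Section LinearCombination.
Context d (T : measurableType d) {R : realType}.
Context (mu : {measure set T -> \bar R}).
Implicit Types (a b : R) (g : T -> R).

Lemma integrable_ZlR a g : mu.-integrable setT (EFin \o g) ->
  mu.-integrable setT (EFin \o (fun x => a * g x)).
Proof. exact: integrableZl. Qed.

Lemma integrable_ZrR a g : mu.-integrable setT (EFin \o g) ->
  mu.-integrable setT (EFin \o (fun x => g x * a)).
Proof. exact: integrableZr. Qed.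

Lemma integrable_addR g1 g2 : mu.-integrable setT (EFin \o g1) ->
  mu.-integrable setT (EFin \o g2) ->
  mu.-integrable setT (EFin \o (fun x => g1 x + g2 x)).
Proof. exact: integrableD. Qed.

Lemma Rintegral_lin2 a b g1 g2 : mu.-integrable setT (EFin \o g1) ->
  mu.-integrable setT (EFin \o g2) ->
  \int[mu]_x (a * g1 x + b * g2 x) = a * \int[mu]_x g1 x + b * \int[mu]_x g2 x.
Proof.
by move=> i1 i2; rewrite RintegralD ?RintegralZl//; exact: integrable_ZlR.
Qed.

End LinearCombination.

(** Convergence is required almost everywhere only, because that is what
Helly selection gives: monotone functions converge off a countable set. *)
Lemma Rintegral_dominated_cvg d (T : measurableType d) (R : realType)
    (mu : {measure set T -> \bar R}) (f_ : nat -> T -> R) (f g : T -> R) :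
  (forall n, measurable_fun setT (f_ n)) -> measurable_fun setT f ->
  {ae mu, forall x, f_ n x @[n --> \oo] --> f x} ->
  mu.-integrable setT (EFin \o g) -> (forall n x, `|f_ n x| <= g x) ->
  \int[mu]_x f_ n x @[n --> \oo] --> \int[mu]_x f x.
Proof.
move=> mf_ mf f_f ig f_g.
have [|||||If _ cf] := @dominated_convergence _ _ _ mu setT measurableT
    (fun n x => (f_ n x)%:E) (EFin \o f) (EFin \o g).
- by move=> n; exact/measurable_EFinP.
- exact/measurable_EFinP.
- by apply: filterS f_f => x f_fx _; apply: cvg_EFin => //; exact: nearW.
- exact: ig.
- by apply: aeW => x n _; rewrite lee_fin f_g.
by apply: fine_cvg; rewrite fineK//; exact: integrable_fin_num.
Qed.

Section FiniteMeasure.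
Context d (T : measurableType d) {R : realType}.
Context (mu : {measure set T -> \bar R}).
Hypothesis mu_fin : (mu setT < +oo)%E.

Lemma bounded_integrable (f : T -> R) (M : R) :
  measurable_fun setT f -> (forall x, `|f x| <= M) ->
  mu.-integrable setT (EFin \o f).
Proof.
move=> mf fM; apply: measurable_bounded_integrable => //.
by exists M; split; [rewrite num_real|move=> r Mr x _; exact: le_trans (fM x) (ltW Mr)].
Qed.

Lemma bounded_dominated_cvg (f_ : nat -> T -> R) (f : T -> R) (M : R) :
  (forall n, measurable_fun setT (f_ n)) -> (forall n x, `|f_ n x| <= M) ->
  (forall x, f_ n x @[n --> \oo] --> f x) ->
  \int[mu]_x f_ n x @[n --> \oo] --> \int[mu]_x f x.
Proof.
move=> mf_ f_M f_f.
have fM x : `|f x| <= M.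
  by apply: (cvgr_to_le (cvg_norm (f_f x))); exact: nearW.
have mf : measurable_fun setT f.
  by apply: (measurable_fun_cvg mf_) => x _; exact: f_f.
apply: (@Rintegral_dominated_cvg _ _ _ mu f_ f (fun=> M)) => //.
- exact: aeW.
- by apply: (@bounded_integrable (fun=> M) `|M|) => //; exact: measurable_cst.
Qed.

Lemma bounded_le_Rintegral (f : T -> R) (M : R) :
  measurable_fun setT f -> (forall x, `|f x| <= M) ->
  `|\int[mu]_x f x| <= M * fine (mu setT).
Proof.
move=> mf fM.
have M0 : forall x : T, 0 <= M by move=> x; exact: le_trans (fM x).
rewrite -Rintegral_cst//.
apply: le_trans (le_normr_Rintegral _ _) _ => //; first exact: bounded_integrable fM.
apply: le_Rintegral => //.
- apply: (@bounded_integrable _ M); first exact: measurableT_comp.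
  by move=> x; rewrite normr_id.
- by apply: (@bounded_integrable _ `|M|) => //; exact: measurable_cst.
Qed.

End FiniteMeasure.

Section BoundedFubini.
Context d1 d2 (T1 : measurableType d1) (T2 : measurableType d2) {R : realType}.
Context (m1 : {finite_measure set T1 -> \bar R}).
Context (m2 : {sigma_finite_measure set T2 -> \bar R}).

(** The first measure will be that of a distribution function and the second
Lebesgue measure, which is not finite: integrability over the product comes
from the factor k, the other factor being bounded. *)
Lemma bounded_Fubini (h : T1 * T2 -> R) (k : T2 -> R) (M : R) :
  measurable_fun setT h -> (forall z, `|h z| <= M) ->
  m2.-integrable setT (EFin \o k) ->
  \int[m1]_x \int[m2]_y (h (x, y) * k y) =
  \int[m2]_y ((\int[m1]_x h (x, y)) * k y).
Proof.
move=> mh hM ik.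
have m1_fin : (m1 setT < +oo)%E by rewrite ltey_eq fin_num_measure.
have mk : measurable_fun setT k by apply/measurable_EFinP; exact: measurable_int ik.
have mhk : measurable_fun setT (fun z : T1 * T2 => h z * k z.2).
  by apply: measurable_funM => //; exact: measurableT_comp.
have mh1 x : measurable_fun setT (fun y => h (x, y)).
  by apply: measurableT_comp => //; exact: pair1_measurable.
have mh2 y : measurable_fun setT (fun x => h (x, y)).
  by apply: measurableT_comp => //; exact: pair2_measurable.
have ik' : m2.-integrable setT (EFin \o (fun y => M * `|k y|)).
  exact: (integrableZl measurableT M (integrable_norm ik)).
have hkM x y : `|h (x, y) * k y| <= M * `|k y| by rewrite normrM ler_wpM2r.
have i2 x : m2.-integrable setT (EFin \o (fun y => h (x, y) * k y)).
  apply: le_integrable ik' => //.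
    by apply/measurable_EFinP; exact: measurable_funM.
  move=> y _ /=; rewrite lee_fin; apply: le_trans (hkM x y) _.
  exact: ler_norm.
(* The majorant is M |k y|, of the same integral for every x. *)
have i12 : (m1 \x m2)%E.-integrable setT (fun z => (h z * k z.2)%:E).
  apply/integrable12ltyP; first exact/measurable_EFinP.
  apply: (@le_lt_trans _ _ (\int[m1]_x (\int[m2]_y (M * `|k y|)%:E))%E).
    apply: ge0_le_integral => //.
    - by move=> x _; apply: integral_ge0.
    - have := @measurable_fun_fubini_tonelli_F _ _ _ _ _ m2
        (fun z : T1 * T2 => `|(h z * k z.2)%:E|%E).
      apply => //; first by apply: measurableT_comp => //; exact/measurable_EFinP.
    move=> x _; apply: ge0_le_integral => //.
    - by apply: measurableT_comp => //; apply/measurable_EFinP; exact: measurable_funM.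
    - exact: measurable_int ik'.
    - by move=> y _; rewrite lee_fin hkM.
  have fik : (\int[m2]_y (M * `|k y|)%:E)%E \is a fin_num by exact: integrable_fin_num ik'.
  rewrite -(fineK fik) integral_cst//.
  rewrite lte_mul_pinfty// lee_fin fine_ge0// integral_ge0// => y _.
  by rewrite lee_fin (le_trans _ (hkM point y)).
have /= F := Fubini i12.
rewrite /Rintegral.
transitivity (fine (\int[m1]_x (\int[m2]_y (h (x, y) * k y)%:E))%E).
  congr fine; apply: eq_integral => x _; rewrite fineK//.
  by apply: integrable_fin_num => //; exact: i2.
rewrite F; congr fine; apply: eq_integral => y _.
transitivity (\int[m1]_x ((h (x, y))%:E * (k y)%:E))%E; first by [].
rewrite integralZr//; last exact: (bounded_integrable m1_fin (mh2 y) (fun x => hM (x, y))).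
rewrite EFinM fineK//; apply: integrable_fin_num => //.
exact: (bounded_integrable m1_fin (mh2 y) (fun x => hM (x, y))).
Qed.

End BoundedFubini.

(** * Distribution functions and their laws *)

Section DistributionOfProbability.
Context {R : realType}.
Local Open Scope measure_display_scope.

Definition id_RV : measurableTypeR R -> R := idfun.

HB.instance Definition _ :=
  @isMeasurableFun.Build _ _ _ _ id_RV (@measurable_id _ _ setT).

Definition prob_cdf (P : probability (measurableTypeR R) R) (r : R) : R :=
  fine (cdf (id_RV : {RV P >-> R}) r).

Context (P : probability (measurableTypeR R) R).

Lemma prob_cdfE r : (prob_cdf P r)%:E = P `]-oo, r]%classic.
Proof. by rewrite /prob_cdf fineK ?fin_num_measure// /cdf. Qed.

Let prob_cdf_nd : nondecreasing (prob_cdf P).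
Proof. by move=> *; rewrite fine_le ?fin_num_measure// cdf_nondecreasing. Qed.

Let prob_cdf_rc : right_continuous (prob_cdf P).
Proof.
move=> a; apply: fine_cvg.
by rewrite fineK ?fin_num_measure//; exact: cdf_right_continuous.
Qed.

HB.instance Definition _ :=
  isCumulative.Build R _ R (prob_cdf P) prob_cdf_nd prob_cdf_rc.

Let prob_cdf_Ny : prob_cdf P @ -oo --> (0 : R).
Proof. exact/fine_cvg/cvg_cdfNy0. Qed.

Let prob_cdf_y : prob_cdf P @ +oo --> (1 : R).
Proof. exact/fine_cvg/cvg_cdfy1. Qed.

HB.instance Definition _ :=
  isCumulativeBounded.Build R 0 1 (prob_cdf P) prob_cdf_Ny prob_cdf_y.

Lemma lebesgue_stieltjes_prob_cdf (A : set R) :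
  measurable A -> lebesgue_stieltjes_measure (prob_cdf P) A = P A.
Proof.
move=> mA; apply: lebesgue_stieltjes_measure_unique => [I [[a b]]/= _ <- | //].
rewrite /lebesgue_stieltjes_measure /measure_extension/=.
rewrite measurable_mu_extE/=; last exact: is_ocitv.
have [ab | ba] := leP a b; last first.
  by rewrite set_itv_ge ?wlength0 ?measure0// bnd_simp -leNgt ltW.
rewrite wlength_itv_bnd// EFinB !prob_cdfE.
have -> : `]a, b]%classic = `]-oo, b] `\` `]-oo, a].
  apply/seteqP; split => x /=; rewrite !in_itv/=.
  - by move=> /andP[ax xb]; split => //; apply/negP; rewrite -ltNge.
  - by move=> [-> /negP]; rewrite -ltNge => ->.
rewrite measureD ?setIidr//; first exact: subset_itvl.
by rewrite -ge0_fin_numE// fin_num_measure.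
Qed.

Lemma Rintegral_prob_cdf (g : R -> R) :
  \int[lebesgue_stieltjes_measure (prob_cdf P)]_x g x = \int[P]_x g x.
Proof.
by congr fine; apply: eq_measure_integral => A mA _; exact: lebesgue_stieltjes_prob_cdf.
Qed.

End DistributionOfProbability.

Section DistributionFunctionBasics.
Context {R : realType}.
Implicit Type F : distribution_function R.

Lemma lebesgue_stieltjes_itvNyc F r :
  lebesgue_stieltjes_measure F `]-oo, r]%classic = (F r)%:E.
Proof. exact: cdf_lebesgue_stieltjes_id. Qed.

Lemma charfunE F t : charfun F t =
  (\int[lebesgue_stieltjes_measure F]_x cos (t * x)) +i*
  (\int[lebesgue_stieltjes_measure F]_x sin (t * x)).
Proof.
rewrite /charfun /integralC; congr (_ +i* _).
  by apply: eq_Rintegral => x _ /=; rewrite expR0 mul1r mul0r subr0.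
by apply: eq_Rintegral => x _ /=; rewrite expR0 mul1r mul0r addr0.
Qed.

Lemma charfun_prob_cdf (P : probability (measurableTypeR R) R) t :
  charfun (prob_cdf P) t = (\int[P]_x cos (t * x)) +i* (\int[P]_x sin (t * x)).
Proof. by rewrite charfunE !Rintegral_prob_cdf. Qed.

End DistributionFunctionBasics.

Section LawOfRandomVariable.
Context {R : realType}.

Lemma continuous_cosM (t : R) : continuous (fun x => cos (t * x)).
Proof.
by move=> x; apply: continuous_comp; [exact: mulrl_continuous|exact: continuous_cos].
Qed.

Lemma continuous_sinM (t : R) : continuous (fun x => sin (t * x)).
Proof.
by move=> x; apply: continuous_comp; [exact: mulrl_continuous|exact: continuous_sin].
Qed.

Arguments continuous_cosM t x : clear implicits.
Arguments continuous_sinM t x : clear implicits.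

(** All laws used in the proof, convolutions and two-point laws, are obtained
as laws of explicit variables, so the distribution function and the
characteristic function are produced together. *)
Lemma exists_distribution d (T : measurableType d) (P : probability T R)
    (X : T -> R) : measurable_fun setT X ->
  exists F : distribution_function R,
    (forall r, (F r)%:E = P (X @^-1` `]-oo, r])) /\
    (forall t, charfun F t =
      (\int[P]_x cos (t * X x)) +i* (\int[P]_x sin (t * X x))).
Proof.
move=> mX.
pose X' : {RV P >-> measurableTypeR R} :=
  HB.pack (X : T -> measurableTypeR R)
    (@isMeasurableFun.Build _ _ _ _ (X : T -> measurableTypeR R) mX).
pose Q : probability (measurableTypeR R) R := distribution P X'.
exists (prob_cdf Q); split.
  by move=> r; rewrite prob_cdfE.
have P1 : (P setT < +oo)%E by rewrite probability_setT ltry.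
have push (g : R -> R) : continuous g -> (forall x, `|g x| <= 1) ->
    \int[Q]_x g x = \int[P]_x g (X x).
  move=> cg g1; rewrite /Rintegral /Q /distribution integral_pushforward//.
    by apply/measurable_EFinP; exact: continuous_measurable_fun.
  rewrite preimage_setT.
  apply: (@bounded_integrable _ _ _ P P1 (g \o X) 1) => [|x]; last exact: g1.
  by apply: measurableT_comp => //; exact: continuous_measurable_fun.
move=> t; rewrite charfun_prob_cdf.
congr (_ +i* _).
- exact: (push (fun y => cos (t * y)) (continuous_cosM t) (fun x => cos_max _)).
- exact: (push (fun y => sin (t * y)) (continuous_sinM t) (fun x => sin_max _)).
Qed.

(** The sum of the coordinates on the product of the two measures has the
convolution as its distribution function, by taking sections, and the product
as its characteristic function, by Fubini and the addition formulas. *)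
Lemma convolution_distribution (F1 F2 : distribution_function R) :
  exists F : distribution_function R,
    (forall x, F x = convolution F1 F2 x) /\
    (forall t, charfun F t = charfun F1 t * charfun F2 t).
Proof.
pose m1 := lebesgue_stieltjes_measure F1 : probability (measurableTypeR R) R.
pose m2 := lebesgue_stieltjes_measure F2 : probability (measurableTypeR R) R.
pose P := (m2 \x m1)%E : probability (measurableTypeR R * measurableTypeR R)%type R.
have madd : measurable_fun setT (fun z : measurableTypeR R * measurableTypeR R => z.1 + z.2).
  by apply: measurable_funD; [exact: measurable_fst|exact: measurable_snd].
have [F [FE cF]] := exists_distribution P madd.
have c2 : (m2 setT < +oo)%E by rewrite probability_setT ltry.
exists F; split.
  move=> r; apply: EFin_inj; rewrite FE /P /product_measure1 /convolution /Rintegral.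
  have E y : (m1 \o xsection ((fun z : R * R => z.1 + z.2) @^-1` `]-oo, r])) y =
      (F1 (r - y))%:E.
    rewrite /= -lebesgue_stieltjes_itvNyc; congr (_ _); apply/seteqP.
    by split => x /=; rewrite /xsection/= inE/= !in_itv/= lerBrDl.
  transitivity (\int[m2]_y (F1 (r - y))%:E)%E; first by apply: eq_integral => y _; exact: E.
  rewrite fineK//; apply: integrable_fin_num => //.
  apply: (@bounded_integrable _ _ _ m2 c2 (fun y => F1 (r - y)) 1).
    apply: (measurableT_comp (f := F1)).
      by apply: nondecreasing_measurable => //; exact: cumulative_is_nondecreasing.
    by apply: measurable_funB => //; exact: measurable_id.
  move=> y; rewrite -lee_fin.
  rewrite ger0_norm -?lee_fin -lebesgue_stieltjes_itvNyc ?measure_ge0//.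
  exact: probability_le1.
have cP : (P setT < +oo)%E by rewrite probability_setT ltry.
have c1 : (m1 setT < +oo)%E by rewrite probability_setT ltry.
have mt (g : R -> R) t : continuous g ->
    measurable_fun setT (fun x : measurableTypeR R => g (t * x)).
  move=> cg; apply: (measurableT_comp (f := g)); first exact: continuous_measurable_fun.
  exact: mulrl_measurable.
have imc t := bounded_integrable c1 (mt cos t (@continuous_cos R)) (fun=> cos_max _).
have ims t := bounded_integrable c1 (mt sin t (@continuous_sin R)) (fun=> sin_max _).
have imc2 t := bounded_integrable c2 (mt cos t (@continuous_cos R)) (fun=> cos_max _).
have ims2 t := bounded_integrable c2 (mt sin t (@continuous_sin R)) (fun=> sin_max _).
have FR (g : R -> R) t : continuous g -> (forall x, `|g x| <= 1) ->
    \int[P]_z g (t * (z.1 + z.2)) = \int[m2]_y \int[m1]_x g (t * y + t * x).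
  move=> cg g1.
  have mg : measurable_fun setT (fun z : measurableTypeR R * measurableTypeR R =>
      g (t * (z.1 + z.2))).
    exact: (measurableT_comp (mt g t cg) madd).
  have ig := bounded_integrable cP mg (fun=> g1 _).
  rewrite /Rintegral /P -[X in fine X = _]integral12_prod_meas1//; congr fine.
  apply: eq_integral => y _; rewrite fineK.
    by apply: eq_integral => x _; rewrite /= mulrDr.
  apply: integrable_fin_num => //; apply: (bounded_integrable c1 _ (fun=> g1 _)).
  apply: (measurableT_comp (f := g)); first exact: continuous_measurable_fun.
  by apply: measurable_funD => //; exact: mulrl_measurable.
move=> t; rewrite cF !charfunE -/m1 -/m2.
set C1 := Rintegral m1 _ _; set S1 := Rintegral m1 _ _.
set C2 := Rintegral m2 _ _; set S2 := Rintegral m2 _ _.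
have EC : \int[P]_z cos (t * (z.1 + z.2)) = C2 * C1 - S2 * S1.
  rewrite (FR cos t (@continuous_cos R) (@cos_max R)).
  transitivity (\int[m2]_y (C1 * cos (t * y) + - S1 * sin (t * y))); last first.
    by rewrite (Rintegral_lin2 _ _ (imc2 t) (ims2 t)) -/C2 -/S2; ring.
  apply: eq_Rintegral => y _.
  transitivity (\int[m1]_x (cos (t * y) * cos (t * x) + - sin (t * y) * sin (t * x))).
    by apply: eq_Rintegral => x _; rewrite cosD; ring.
  by rewrite (Rintegral_lin2 _ _ (imc t) (ims t)) -/C1 -/S1; ring.
have ES : \int[P]_z sin (t * (z.1 + z.2)) = S2 * C1 + C2 * S1.
  rewrite (FR sin t (@continuous_sin R) (@sin_max R)).
  transitivity (\int[m2]_y (C1 * sin (t * y) + S1 * cos (t * y))); last first.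
    have key (c s : R) : C1 * s + S1 * c = s * C1 + c * S1 by ring.
    apply: eq_trans (Rintegral_lin2 _ _ (ims2 t) (imc2 t)) _.
    exact: key.
  apply: eq_Rintegral => y _.
  transitivity (\int[m1]_x (sin (t * y) * cos (t * x) + cos (t * y) * sin (t * x))).
    by apply: eq_Rintegral => x _; rewrite sinD; ring.
  by rewrite (Rintegral_lin2 _ _ (imc t) (ims t)) -/C1 -/S1; ring.
by rewrite EC ES; apply/eqP; rewrite eq_complex/=; apply/andP; split; apply/eqP; ring.
Qed.

End LawOfRandomVariable.
Arguments continuous_cosM {R} t x.
Arguments continuous_sinM {R} t x.

(** * The Laplace transform of the cosine *)

Section LaplaceTransform.
Context {R : realType}.
Notation mu := (@lebesgue_measure R).

Lemma continuous_is_derive (F f : R -> R) :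
  (forall x, is_derive (x : R) (1 : R) F (f x)) -> continuous F.
Proof.
move=> dF x; apply: differentiable_continuous; apply/derivable1_diffP.
by have [] := dF x.
Qed.

Lemma Rintegral_FTC2 (f F : R -> R) (a b : R) : a <= b ->
  (forall x, is_derive (x : R) (1 : R) F (f x)) -> continuous f ->
  \int[mu]_(x in `[a, b]) f x = F b - F a.
Proof.
rewrite le_eqVlt => /predU1P[<-|ab] dF cf.
  by rewrite set_itv1 Rintegral_set1 subrr.
have cF := continuous_is_derive dF.
rewrite /Rintegral (@continuous_FTC2 _ f F)//.
- exact: continuous_subspaceT.
- split.
  + by move=> x _; have [] := dF x.
  + exact: cvg_at_right_filter (cF a).
  + exact: cvg_at_left_filter (cF b).
- by move=> x _; rewrite derive1E; have [_ ->] := dF x.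
Qed.

Lemma is_derive_exp_trig (y r : R) : is_derive (r : R) (1 : R)
  (fun r => expR (- r) * (y * sin (y * r) - cos (y * r)) / (1 + y ^+ 2))
  (expR (- r) * cos (y * r)).
Proof.
have y1 : 1 + y ^+ 2 != 0 by rewrite gt_eqF// ltr_pwDl// sqr_ge0.
apply: is_derive_eq.
rewrite /GRing.scale/=; by field.
Qed.

Lemma continuous_exp_cos (y : R) : continuous (fun r => expR (- r) * cos (y * r)).
Proof.
move=> x; apply: cvgM; last exact: continuous_cosM.
by apply: continuous_comp; [exact: opp_continuous|exact: continuous_expR].
Qed.

(** An exponentially weighted cosine integral is the Cauchy kernel. This is
the bridge from characteristic functions back to measures: the weight is
integrable, the kernel is positive, and the integral is elementary. The
antiderivative is evaluated on [0, n], and the exponential density dominates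
the passage to the limit. *)
Lemma laplace_cos (y : R) :
  \int[mu]_r (cos (y * r) * exponential_pdf 1 r) = (1 + y ^+ 2)^-1.
Proof.
have y1 : 1 + y ^+ 2 != 0 by rewrite gt_eqF// ltr_pwDl// sqr_ge0.
pose f_ (n : nat) (r : R) : R := \1_`[0, n%:R] r * (expR (- r) * cos (y * r)).
have fE n : \int[mu]_r f_ n r =
    expR (- n%:R) * (y * sin (y * n%:R) - cos (y * n%:R)) / (1 + y ^+ 2) +
    (1 + y ^+ 2)^-1.
  transitivity (\int[mu]_(r in `[0, n%:R]) (expR (- r) * cos (y * r))).
    rewrite [RHS]Rintegral_mkcond; apply: eq_Rintegral => r _.
    by rewrite /f_ patchE indicE; case: ifP; rewrite ?mul1r ?mul0r.
  rewrite (Rintegral_FTC2 _ (is_derive_exp_trig y))//.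
    by rewrite mulr0 oppr0 expR0 sin0 cos0; field.
  exact: continuous_exp_cos.
have f_cvg : \int[mu]_r f_ n r @[n --> \oo] -->
    \int[mu]_r (cos (y * r) * exponential_pdf 1 r).
  apply: (@Rintegral_dominated_cvg _ _ R mu f_
    (fun r => cos (y * r) * exponential_pdf 1 r) (exponential_pdf 1)).
  - move=> n; apply: measurable_funM; first exact: measurable_indic.
    by apply: continuous_measurable_fun; exact: continuous_exp_cos.
  - apply: measurable_funM; last exact: measurable_exponential_pdf.
    by apply: continuous_measurable_fun; exact: continuous_cosM.
  - apply: aeW => r; have [r0|r0] := leP 0 r; last first.
      rewrite lt0_exponential_pdf// mulr0 (_ : (fun n => _) = cst 0); first exact: cvg_cst.
      by apply/funext => n; rewrite /f_ indicE mem_setE in_itv/= leNgt r0 mul0r.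
    apply: cvg_near_cst; near=> n.
    rewrite /f_ indicE mem_setE in_itv/= r0 (_ : r <= n%:R) ?mul1r ?exponential_pdfE//=.
      by rewrite mulN1r mul1r mulrC.
    by near: n; exact: nbhs_infty_ger.
  - exact: integrable_exponential_pdf.
  - move=> n r; rewrite /f_ indicE mem_setE in_itv/=.
    have [r0|r0] := leP 0 r; last by rewrite mul0r normr0 exponential_pdf_ge0.
    rewrite exponential_pdfE// !mulN1r !mul1r 2!normrM (gtr0_norm (expR_gt0 _)).
    rewrite -[leRHS]mul1r ler_pM// ?mulr_ge0// ?expR_ge0//.
      by case: (r <= n%:R); rewrite ?normr1 ?normr0.
    by rewrite ler_piMr ?expR_ge0// cos_max.
have lim2 : \int[mu]_r f_ n r @[n --> \oo] --> (1 + y ^+ 2)^-1.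
  rewrite (_ : (fun n => _) = (fun n => expR (- n%:R) *
    (y * sin (y * n%:R) - cos (y * n%:R)) / (1 + y ^+ 2) + (1 + y ^+ 2)^-1)); last first.
    by apply/funext => n; rewrite fE.
  rewrite -[X in _ --> X]add0r; apply: cvgD; last exact: cvg_cst.
  have exp0 : expR (- n%:R) * ((`|y| + 1) / (1 + y ^+ 2)) @[n --> \oo] --> (0 : R).
    rewrite -[X in _ --> X](mul0r ((`|y| + 1) / (1 + y ^+ 2))).
    apply: cvgM; last exact: cvg_cst.
    exact: (cvg_comp _ _ (@cvgr_idn R) (@cvgr_expR R)).
  apply: (@squeeze_cvgr _ _ _ _ (fun n : nat => - (expR (- n%:R) * ((`|y| + 1) / (1 + y ^+ 2))))
    (fun n : nat => expR (- n%:R) * ((`|y| + 1) / (1 + y ^+ 2)))).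
  - near=> n; rewrite -ler_norml !normrM (gtr0_norm (expR_gt0 _)) -mulrA.
    rewrite ler_wpM2l ?expR_ge0// [X in _ * X]ger0_norm ?invr_ge0 ?addr_ge0 ?sqr_ge0//.
    rewrite ler_wpM2r ?invr_ge0 ?addr_ge0 ?sqr_ge0//.
    apply: le_trans (ler_normB _ _) _; rewrite lerD ?cos_max// normrM.
    by rewrite ler_piMr// sin_max.
  - by rewrite -oppr0; apply: cvgN; exact: exp0.
  - exact: exp0.
exact: (cvg_unique _ f_cvg lim2).
Unshelve. all: by end_near.
Qed.
End LaplaceTransform.

(** * Uniqueness of characteristic functions *)

Section Uniqueness.
Context {R : realType}.
Notation mu := (@lebesgue_measure R).
Implicit Types F : distribution_function R.

Lemma measurable_cosM2 (s u : R) : measurable_fun setT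
  (fun z : measurableTypeR R * measurableTypeR R => cos (s * (z.1 - u) * z.2)).
Proof.
apply: (measurableT_comp (f := cos)).
  by apply: continuous_measurable_fun; exact: continuous_cos.
apply: measurable_funM; last exact: measurable_snd.
apply: measurable_funM; first exact: measurable_cst.
by apply: measurable_funB; [exact: measurable_fst|exact: measurable_cst].
Qed.

Lemma LS_setT_lty F : (lebesgue_stieltjes_measure F setT < +oo)%E.
Proof. by rewrite probability_setT ltry. Qed.

Lemma Rintegral_cst_LS F (c : R) : \int[lebesgue_stieltjes_measure F]_x c = c.
Proof.
rewrite Rintegral_cst//.
by rewrite (_ : fine _ = fine 1%E) ?mulr1//; congr fine; exact: probability_setT.
Qed.

Lemma integrable_cosM F t :
  (lebesgue_stieltjes_measure F).-integrable setT (EFin \o (fun x => cos (t * x))).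
Proof.
apply: (@bounded_integrable _ _ _ _ (LS_setT_lty F) _ 1) => [|x]; last exact: cos_max.
by apply: continuous_measurable_fun; exact: continuous_cosM.
Qed.

Lemma integrable_sinM F t :
  (lebesgue_stieltjes_measure F).-integrable setT (EFin \o (fun x => sin (t * x))).
Proof.
apply: (@bounded_integrable _ _ _ _ (LS_setT_lty F) _ 1) => [|x]; last exact: sin_max.
by apply: continuous_measurable_fun; exact: continuous_sinM.
Qed.

Lemma Re_charfun F t :
  complex.Re (charfun F t) = \int[lebesgue_stieltjes_measure F]_x cos (t * x).
Proof. by rewrite charfunE. Qed.

Lemma Im_charfun F t :
  complex.Im (charfun F t) = \int[lebesgue_stieltjes_measure F]_x sin (t * x).
Proof. by rewrite charfunE. Qed.

(** Fubini and the Laplace transform of the cosine. The right-hand side sees F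
only through its characteristic function, and the left-hand side tests F
against a positive approximate identity centred at u. *)
Lemma cauchy_transform F (s u : R) :
  \int[lebesgue_stieltjes_measure F]_x (1 + (s * (x - u)) ^+ 2)^-1 =
  \int[mu]_r ((cos (s * u * r) * complex.Re (charfun F (s * r)) +
               sin (s * u * r) * complex.Im (charfun F (s * r))) *
              exponential_pdf 1 r).
Proof.
transitivity (\int[lebesgue_stieltjes_measure F]_x
    \int[mu]_r (cos (s * (x - u) * r) * exponential_pdf 1 r)).
  by apply: eq_Rintegral => x _; rewrite laplace_cos.
rewrite (@bounded_Fubini _ _ _ _ R (lebesgue_stieltjes_measure F) mu
  (fun z => cos (s * (z.1 - u) * z.2)) (exponential_pdf 1) 1); last 3 first.
- exact: measurable_cosM2.
- by move=> z; exact: cos_max.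
- exact: integrable_exponential_pdf.
apply: eq_Rintegral => r _; congr (_ * _); rewrite Re_charfun Im_charfun.
rewrite -(Rintegral_lin2 _ _ (integrable_cosM F _) (integrable_sinM F _)).
apply: eq_Rintegral => x _.
rewrite (_ : s * (x - u) * r = s * r * x - s * u * r); last by ring.
by rewrite cosB; ring.
Qed.

(** Up to the factor s, an antiderivative in u of the Cauchy means at scale s.
As s grows, atan (s (u - x)) tends to a step at x = u, so this function
recovers F. *)
Definition atan_transform F (s u : R) :=
  \int[lebesgue_stieltjes_measure F]_x atan (s * (u - x)).

Lemma continuous_atanM (s u : R) : continuous (fun x : R => atan (s * (u - x))).
Proof.
move=> x; apply: continuous_comp; last exact: continuous_atan.
by apply: continuousM; [exact: cst_continuous|apply: continuousB; [exact: cst_continuous|]].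
Qed.

Lemma measurable_atanM (s u : R) :
  measurable_fun setT (fun x : measurableTypeR R => atan (s * (u - x))).
Proof. by apply: continuous_measurable_fun; exact: continuous_atanM. Qed.

Lemma atan_max (x : R) : `|atan x| <= pi / 2.
Proof. by rewrite ler_norml !ltW// ?atan_gtNpi2 ?atan_ltpi2. Qed.

Lemma is_derive_atan_transform F (s u : R) : is_derive (u : R) (1 : R) (atan_transform F s)
  (s * \int[lebesgue_stieltjes_measure F]_x (1 + (s * (x - u)) ^+ 2)^-1).
Proof.
have mF := LS_setT_lty F.
have der (x v : R) : is_derive (v : R) (1 : R) (fun v => atan (s * (v - x)))
    (s * (1 + (s * (x - v)) ^+ 2)^-1).
  apply: is_derive_eq; rewrite /GRing.scale/=.
  rewrite (_ : (s * (v - x)) ^+ 2 = (s * (x - v)) ^+ 2); last by ring.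
  ring.
have cauchy_le1 (x v : R) : `|(1 + (s * (x - v)) ^+ 2)^-1| <= 1.
  by rewrite ger0_norm ?invr_ge0 ?addr_ge0 ?sqr_ge0// invf_le1 ?lerDl ?ltr_pwDl ?sqr_ge0.
have Iu : `]u - 1, u + 1[%classic u by rewrite /= in_itv/= ltrBlDr ltrDl ltr01.
have intf v : `]u - 1, u + 1[%classic v ->
    (lebesgue_stieltjes_measure F).-integrable setT (EFin \o (fun x => atan (s * (v - x)))).
  by move=> _; apply: (bounded_integrable mF (measurable_atanM s v)) => x; exact: atan_max.
have derf v x : `]u - 1, u + 1[%classic v -> setT x ->
    derivable (fun v => atan (s * (v - x))) v 1.
  by move=> _ _; have [] := der x v.
have dE x v : partial1of2 (fun v x => atan (s * (v - x))) v x = s * (1 + (s * (x - v)) ^+ 2)^-1.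
  by rewrite partial1of2E; have [_ ->] := der x v.
have intG : (lebesgue_stieltjes_measure F).-integrable setT (EFin \o (fun=> `|s|)).
  by apply: (bounded_integrable mF (M := `|s|)) => [|x]; [exact: measurable_cst|rewrite normr_id].
have ub v x : `]u - 1, u + 1[%classic v -> setT x ->
    `|partial1of2 (fun v x => atan (s * (v - x))) v x| <= `|s|.
  by move=> _ _; rewrite dE normrM ler_piMr.
apply: DeriveDef.
  exact: (derivable_under_integral measurableT Iu intf derf (fun=> normr_ge0 s) intG ub).
rewrite -derive1E.
rewrite (differentiation_under_integral measurableT Iu intf derf (fun=> normr_ge0 s) intG ub).
under eq_Rintegral do rewrite dE.
rewrite RintegralZl//; apply: (bounded_integrable mF (M := 1)) => //.
apply: continuous_measurable_fun => x; apply: cvgV.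
  by rewrite gt_eqF// ltr_pwDl// sqr_ge0.
apply: cvgD; first exact: cvg_cst.
apply: (@continuous_comp _ _ _ (fun x : R => s * (x - u)) (fun y : R => y ^+ 2)).
  by apply: cvgM; [exact: cvg_cst|apply: cvgB; [exact: cvg_id|exact: cvg_cst]].
exact: exprn_continuous.
Qed.

Lemma atan_transform_cvg F (s_ u_ : R^nat) (g : R -> R) :
  (forall x, atan (s_ n * (u_ n - x)) @[n --> \oo] --> g x) ->
  atan_transform F (s_ n) (u_ n) @[n --> \oo] -->
  \int[lebesgue_stieltjes_measure F]_x g x.
Proof.
move=> cg; apply: (bounded_dominated_cvg (LS_setT_lty F) _ _ cg) => [n|n x].
  exact: measurable_atanM.
exact: atan_max.
Qed.

Lemma cvg_atan_Ny (u_ : R^nat) :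
  u_ @ \oo --> -oo -> atan (u_ n) @[n --> \oo] --> (- (pi / 2) : R).
Proof.
move=> uNy; rewrite (_ : (fun n => _) = (fun n => - atan (- u_ n))); last first.
  by apply/funext => n; rewrite atanN opprK.
apply: cvgN; apply: (cvg_comp _ _ _ (@cvgy_atan R)).
exact: (cvgNry u_).2 uNy.
Qed.

(** The derivatives in u agree by the Cauchy transform, and both functions
tend to -pi/2 when u goes to -oo, which fixes the constant of integration. *)
Lemma charfun_atan_transform F F' (s u : R) : charfun F =1 charfun F' -> 0 < s ->
  atan_transform F s u = atan_transform F' s u.
Proof.
move=> FF' s0.
have dD v : is_derive (v : R) (1 : R) (atan_transform F s \- atan_transform F' s) 0.
  apply: is_derive_eq.
    by apply: is_deriveB; exact: is_derive_atan_transform.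
  have E : \int[lebesgue_stieltjes_measure F]_x (1 + (s * (x - v)) ^+ 2)^-1 =
      \int[lebesgue_stieltjes_measure F']_x (1 + (s * (x - v)) ^+ 2)^-1.
    rewrite (cauchy_transform F) (cauchy_transform F').
    by apply: eq_Rintegral => r _; rewrite FF'.
  by rewrite E subrr.
have limNy H : atan_transform H s (u - n%:R) @[n --> \oo] --> (- (pi / 2) : R).
  rewrite [X in _ --> X](_ : _ = \int[lebesgue_stieltjes_measure H]_x - (pi / 2)); last first.
    by rewrite Rintegral_cst_LS.
  apply: (@atan_transform_cvg H (fun=> s)) => x; apply: cvg_atan_Ny.
  apply/cvgNry; rewrite (_ : - _ = (fun n : nat => s * (n%:R + (x - u)))); last first.
    by apply/funext => n /=; rewrite -[LHS]/(- (s * (u - n%:R - x))); ring.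
  exact: (cvg_comp _ _ (cvg_comp _ _ (@cvgr_idn R) (cvg_addrr (x - u)))
    (gt0_cvgMry s0 cvg_id)).
have lim0 : (atan_transform F s \- atan_transform F' s) (u - n%:R) @[n --> \oo] --> (0 : R).
  by rewrite -[X in _ --> X](subrr (- (pi / 2))); apply: cvgB; exact: limNy.
apply/eqP; rewrite -subr_eq0; apply/eqP.
rewrite -[LHS]/((atan_transform F s \- atan_transform F' s) u).
have limc : (atan_transform F s \- atan_transform F' s) (u - n%:R) @[n --> \oo] -->
    (atan_transform F s \- atan_transform F' s) u.
  rewrite (_ : (fun n => _) = cst ((atan_transform F s \- atan_transform F' s) u)).
    exact: cvg_cst.
  by apply/funext => n; exact: (is_derive_0_is_cst (u - n%:R) u dD).
exact: (cvg_unique _ limc lim0).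
Qed.

(** The scale is the square of n + 1 and the evaluation point is moved to
u + 1 / (n + 1): the product of the two grows, so the atom x = u is counted
in full and the limit is the right-continuous step. *)
Lemma atan_step (u x : R) :
  atan (n.+1%:R ^+ 2 * (u + n.+1%:R^-1 - x)) @[n --> \oo] -->
  pi * \1_(`]-oo, u]%classic) x - pi / 2.
Proof.
have e n : n.+1%:R ^+ 2 * (u + n.+1%:R^-1 - x) = n.+1%:R ^+ 2 * (u - x) + n.+1%:R.
  have : (n.+1%:R : R) != 0 by rewrite pnatr_eq0.
  by move: (n.+1%:R : R) => N N0; field.
under eq_fun do rewrite e.
rewrite indicE mem_setE in_itv/=; have [xu|ux] := leP x u.
  rewrite (_ : pi * true%:R - pi / 2 = pi / 2); last by rewrite mulr1; field.
  apply: (cvg_comp _ _ _ (@cvgy_atan R)); apply/cvgryPge => A; near=> n.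
  rewrite (@le_trans _ _ n.+1%:R)// ?lerDr ?mulr_ge0 ?exprn_ge0 ?subr_ge0//.
  rewrite (@le_trans _ _ n%:R)// ?ler_nat//.
  by near: n; exact: nbhs_infty_ger.
rewrite (_ : pi * false%:R - pi / 2 = - (pi / 2)); last by rewrite mulr0 sub0r.
apply: cvg_atan_Ny; apply/cvgrNyPle => A; near=> n.
have n2 : 2 / (x - u) <= n.+1%:R.
  by rewrite (@le_trans _ _ n%:R)// ?ler_nat//; near: n; exact: nbhs_infty_ger.
have nA : - A <= n.+1%:R.
  by rewrite (@le_trans _ _ n%:R)// ?ler_nat//; near: n; exact: nbhs_infty_ger.
rewrite ler_pdivrMr ?subr_gt0// in n2.
have n0 : (0 : R) < n.+1%:R by [].
nra.
Unshelve. all: by end_near.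
Qed.

(** The transforms of F and F' agree, and along the steps of the previous
lemma they converge to pi F(u) - pi/2 and pi F'(u) - pi/2. *)
Lemma charfun_inj F F' : charfun F =1 charfun F' -> F =1 F'.
Proof.
move=> FF' u.
have lim H : atan_transform H (n.+1%:R ^+ 2) (u + n.+1%:R^-1) @[n --> \oo] -->
    pi * H u - pi / 2.
  rewrite [X in _ --> X](_ : _ = \int[lebesgue_stieltjes_measure H]_x
      (pi * \1_(`]-oo, u]%classic) x - pi / 2)).
    by apply: (@atan_transform_cvg H) => x; exact: atan_step.
  have iI : (lebesgue_stieltjes_measure H).-integrable setT
      (EFin \o \1_(`]-oo, u]%classic)) by exact: integrable_indic.
  have i1 : (lebesgue_stieltjes_measure H).-integrable setT (EFin \o cst (1 : R)).
    exact: finite_measure_integrable_cst.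
  transitivity (\int[lebesgue_stieltjes_measure H]_x
      (pi * \1_(`]-oo, u]%classic) x + - (pi / 2) * 1)).
    rewrite (Rintegral_lin2 _ _ iI i1) Rintegral_cst_LS mulr1.
    rewrite /Rintegral integral_indic// setIT; congr (pi * _ - _).
    by rewrite -[LHS]/(fine (H u)%:E); congr fine; rewrite -lebesgue_stieltjes_itvNyc.
  by apply: eq_Rintegral => x _; rewrite mulr1.
have : pi * F u - pi / 2 = pi * F' u - pi / 2.
  have limF := lim F; have limF' := lim F'.
  rewrite (_ : (fun n => _) = (fun n => atan_transform F' (n.+1%:R ^+ 2)
    (u + n.+1%:R^-1))) in limF; first exact: (cvg_unique _ limF limF').
  by apply/funext => n; rewrite (charfun_atan_transform _ FF') ?exprn_gt0.
move=> /addIr/mulfI; apply; rewrite gt_eqF//; exact: pi_gt0.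
Qed.

End Uniqueness.

(** * Helly selection *)

Section Helly.
Context {R : realType}.
Notation mu := (@lebesgue_measure R).

Lemma ultra_limit (U : set_system nat) (u : R^nat) : UltraFilter U ->
  (forall n, 0 <= u n <= 1) -> exists l : R, u @ U --> l.
Proof.
move=> UU u01.
have [|l [_ ul]] := @segment_compact R 0 1 (u @ U) _.
  by apply: (@filterE _ U) => n; rewrite /= in_itv/= u01.
exists l => V lV.
have [//|UnV] := in_ultra_setVsetC (u @^-1` V) UU.
by have [x [nVx /nVx]] := ul (~` V) V UnV lV.
Qed.

(** A limit along an ultrafilter exists at all points at once, which replaces
the diagonal argument; the limit H is monotone and F is its right-continuous
regularisation. The convergence is recorded in a form that avoids continuity
points: between any x < y some q has F_ (k n) q convergent, to a value between
F x and F y. *)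
Lemma helly (F_ : nat -> R -> R) :
  (forall n, nondecreasing (F_ n)) -> (forall n x, 0 <= F_ n x <= 1) ->
  exists (k : nat -> nat) (F : R -> R),
  [/\ k @ \oo --> \oo, nondecreasing F, right_continuous F,
    (forall x, 0 <= F x <= 1) &
    forall x y, x < y -> exists q l : R, [/\ x < q < y, F x <= l <= F y &
      F_ (k n) q @[n --> \oo] --> l]].
Proof.
move=> ndF F01.
have [U [UU ooU]] := ultraFilterLemma (_ : ProperFilter \oo).
have /choice[H HU] : forall x : R, exists l : R, F_ ^~ x @ U --> l.
  by move=> x; apply: ultra_limit => // n; exact: F01.
have Hnd : nondecreasing H.
  move=> x y xy; apply: (ler_cvg_to (HU x) (HU y)).
  by apply: (@filterE _ U) => n; exact: ndF.
have H0 x : 0 <= H x.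
  by apply: (cvgr_to_ge (HU x)); apply: filterS filterT => n _; have /andP[] := F01 n x.
have H1 x : H x <= 1.
  by apply: (cvgr_to_le (HU x)); apply: filterS filterT => n _; have /andP[] := F01 n x.
(* The index k j is taken where the sequence is within 1/(j+1) of H at the
first j + 1 rationals; it exists because such indices form a set of U. *)
pose good (j n : nat) := (j <= n)%N /\ forall i : 'I_j.+1, forall q : rat,
  unpickle i = Some q -> `|H (ratr q) - F_ n (ratr q)| < j.+1%:R^-1.
have /choice[k kP] : forall j, exists n, good j n.
  move=> j; apply: (@filter_ex _ U); apply: filterI.
    by apply: ooU; exact: nbhs_infty_ge.
  apply: filter_forall => i; case: (unpickle i) => [q|]; last exact: filterE.
  have /cvgrPdist_lt/(_ j.+1%:R^-1) := HU (ratr q).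
  by move=> /(_ _)/filterS; apply=> // n Hn _ [<-].
have kq q : F_ (k n) (ratr q) @[n --> \oo] --> H (ratr q).
  apply/cvgrPdist_lt => e e0; near=> n.
  have qn : (pickle q < n.+1)%N by rewrite ltnS; near: n; exact: nbhs_infty_ge.
  apply: lt_trans ((kP n).2 (Ordinal qn) q (pickleK q)) _.
  by near: n; exact: (near_infty_natSinv_lt (PosNum e0)).
(* Only values of H strictly to the right of x enter F x, which makes F
right-continuous. *)
pose S (x : R) := [set H q | q in [set q | x < q]].
have hS x : has_inf (S x).
  split; first by exists (H (x + 1)); exists (x + 1) => //=; rewrite ltrDl.
  by exists 0 => _ [q _ <-].
pose F x := inf (S x).
have FH x q : x < q -> F x <= H q.
  by move=> xq; apply: ge_inf; [exact: (hS x).2|exists q].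
have HF x q : q <= x -> H q <= F x.
  move=> qx; apply: lb_le_inf; first exact: (hS x).1.
  by move=> _ [z /= xz <-]; apply: Hnd; exact: ltW (le_lt_trans qx xz).
have Fnd : nondecreasing F.
  move=> x y; rewrite le_eqVlt => /predU1P[->//|xy].
  exact: le_trans (FH _ _ xy) (HF _ _ (lexx y)).
exists k, F; split => //.
- by move=> A [N _ NA]; exists N => // n Nn; apply: NA => /=; exact: leq_trans Nn (kP n).1.
- move=> x; apply/cvgrPdist_lt => e e0.
  have [_ [q /= xq <-] qe] := inf_adherent e0 (hS x).
  near=> y.
  have xy : x < y by near: y; exact: nbhs_right_gt.
  have yq : y < q by near: y; exact: nbhs_right_lt.
  rewrite distrC ger0_norm ?subr_ge0 ?Fnd ?(ltW xy)// ltrBlDl.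
  exact: le_lt_trans (FH y q yq) qe.
- by move=> x; rewrite (le_trans (H0 x) (HF _ _ (lexx x)))
    (le_trans (FH x (x + 1) _) (H1 _))// ltrDl.
- move=> x y xy; have [q] := rat_in_itvoo xy.
  rewrite in_itv/= => /andP[xq qy].
  exists (ratr q), (H (ratr q)); split=> //; first by rewrite xq.
  by rewrite FH// HF// ltW.
Unshelve. all: by end_near.
Qed.

(** The discontinuities of a monotone function are countable on every bounded
interval. *)
Lemma nondecreasing_continuous_ae (F : R -> R) : nondecreasing F ->
  right_continuous F -> {ae mu, forall x, F y @[y --> x] --> F x}.
Proof.
move=> ndF rcF.
pose D (n : nat) := [set x : R | (x \in `]- n%:R, n%:R[) /\ discontinuity F x].
have cD : countable (\bigcup_n D n).
  apply: bigcup_countable => // n _; apply: discontinuity_countable => x y _ _.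
  exact: ndF.
exists (\bigcup_n D n); split.
- exact: countable_measurable.
- exact: countable_lebesgue_measure0.
- move=> x /= ncx; exists (Num.truncn `|x|).+1 => //; split.
    by rewrite in_itv/= -ltr_norml truncnS_gt.
  have cl : cvg (F y @[y --> x^'-]).
    apply: nondecreasing_at_left_is_cvgr.
      by apply: nearW => y a b _ _; exact: ndF.
    by near=> y; exists (F x) => _ [z /= /[!in_itv]/= /andP[_ zx] <-]; exact/ndF/ltW.
  split => //; first by apply/cvg_ex; exists (F x); exact: rcF.
  apply: contra_notN ncx => /eqP lr.
  have rE : lim (F y @[y --> x^'+]) = F x by apply: cvg_lim => //; exact: rcF.
  apply/left_right_continuousP; split; last exact: rcF.
  by rewrite -rE -lr.
Unshelve. all: by end_near.
Qed.

(** At a continuity point x of F, the values at points q < x < r close to x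
where the sequence converges squeeze F_ n x. *)
Lemma helly_ae_cvg (F_ : nat -> R -> R) (F : R -> R) :
  (forall n, nondecreasing (F_ n)) -> nondecreasing F -> right_continuous F ->
  (forall x y, x < y -> exists q l : R, [/\ x < q < y, F x <= l <= F y &
      F_ n q @[n --> \oo] --> l]) ->
  {ae mu, forall x, F_ n x @[n --> \oo] --> F x}.
Proof.
move=> ndF_ ndF rcF H.
have [A [mA A0 sA]] := nondecreasing_continuous_ae ndF rcF.
exists A; split => // x ncvg; apply: sA => cx; apply: ncvg.
apply/cvgrPdist_lt => e e0.
have /cvgrPdist_lt/(_ _ e0) := cx.
move=> /nbhs_ballP[d /= d0 xd].
have [y xdy yx] : exists2 y, x - d < y & y < x.
  by exists (x - d / 2); lra.
have [z xz zxd] : exists2 z, x < z & z < x + d.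
  by exists (x + d / 2); lra.
have Fy : `|F x - F y| < e.
  by apply: xd; rewrite /ball/= ger0_norm; lra.
have Fz : `|F x - F z| < e.
  by apply: xd; rewrite /ball/= ltr0_norm; lra.
have [q [l [/andP[yq qx] /andP[Fyl _] ql]]] := H _ _ yx.
have [r [m [/andP[xr rz] /andP[_ mFz] rm]]] := H _ _ xz.
rewrite ltr_norml in Fy; rewrite ltr_norml in Fz.
near=> n.
have h1 : F x - e < F_ n q.
  near: n; apply: (cvgr_gt _ ql); lra.
have h2 : F_ n r < F x + e.
  near: n; apply: (cvgr_lt _ rm); lra.
have h3 := ndF_ n _ _ (ltW qx); have h4 := ndF_ n _ _ (ltW xr).
rewrite ltr_norml; lra.
Unshelve. all: by end_near.
Qed.

End Helly.

(** * Integration by parts against a distribution function *)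

Section WeakLimit.
Context {R : realType}.
Notation mu := (@lebesgue_measure R).
Notation LS := lebesgue_stieltjes_measure.
Implicit Types F : distribution_function R.

Lemma distribution_function_ge0 F x : 0 <= F x.
Proof. by rewrite -lee_fin -lebesgue_stieltjes_itvNyc measure_ge0. Qed.

Lemma distribution_function_le1 F x : F x <= 1.
Proof. by rewrite -lee_fin -lebesgue_stieltjes_itvNyc probability_le1. Qed.

Lemma measurable_distribution_function F : measurable_fun setT F.
Proof. by apply: nondecreasing_measurable => //; exact: cumulative_is_nondecreasing. Qed.

Lemma Rintegral_indic_itvNyc F y : \int[LS F]_x \1_(`]-oo, y]%classic) x = F y.
Proof.
rewrite /Rintegral integral_indic// setIT.
by rewrite -[RHS]/(fine (F y)%:E); congr fine; rewrite -lebesgue_stieltjes_itvNyc.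
Qed.

Section IntegrationByParts.
Context (g gd : R -> R) (M : R).
Hypothesis M_ge0 : 0 <= M.
Hypothesis dg : forall x, is_derive (x : R) (1 : R) g (gd x).
Hypothesis cgd : continuous gd.
Hypothesis gN : g (- M) = 0.
Hypothesis gM : g M = 0.

Let k (y : R) : R := gd y * \1_(`[- M, M]%classic) y.

Lemma integrable_derive_indic : mu.-integrable setT
  (EFin \o (fun y => gd y * \1_(`[- M, M]%classic) y)).
Proof.
have -> : EFin \o (fun y => gd y * \1_(`[- M, M]%classic) y) = (EFin \o gd) \_ `[- M, M].
  apply/funext => y; rewrite patchE /= indicE.
  by case: ifP; rewrite ?mulr1 ?mulr0.
apply/integrable_restrict => //=; rewrite setTI.
apply: continuous_compact_integrable; first exact: segment_compact.
exact: continuous_subspaceT.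
Qed.

Lemma Rintegral_indic_derive (x : R) :
  \int[mu]_y (\1_(`[x, +oo[%classic) y * k y) = - (g x * \1_(`[- M, M]%classic) x).
Proof.
transitivity (\int[mu]_(y in `[Num.max x (- M), M]) gd y).
  rewrite [RHS]Rintegral_mkcond; apply: eq_Rintegral => y _.
  rewrite /k patchE !indicE !mem_setE !in_itv/= andbT ge_max -andbA.
  by case: (x <= y) => /=; rewrite ?mul1r ?mul0r//; case: (_ && _); rewrite ?mulr1 ?mulr0.
rewrite indicE mem_setE in_itv/=.
have [xM|Mx] := leP x M; last first.
  rewrite set_itv_ge ?Rintegral_set0 ?andbF ?mulr0 ?oppr0//.
  by rewrite bnd_simp -ltNge lt_max Mx.
rewrite (Rintegral_FTC2 _ dg)//; last first.
  by rewrite ge_max xM/= (le_trans _ M_ge0)// oppr_le0.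
rewrite gM sub0r /Num.max; have [xN|xN] := ltP x (- M).
- by rewrite gN mulr0.
- by rewrite mulr1.
Qed.

Lemma integrable_mul_indic F :
  (LS F).-integrable setT (EFin \o (fun x => g x * \1_(`[- M, M]%classic) x)).
Proof.
have cg := continuous_is_derive dg.
have -> : EFin \o (fun x => g x * \1_(`[- M, M]%classic) x) = (EFin \o g) \_ `[- M, M].
  apply/funext => y; rewrite patchE /= indicE.
  by case: ifP; rewrite ?mulr1 ?mulr0.
apply/integrable_restrict => //=; rewrite setTI.
apply: measurable_bounded_integrable => //.
- apply: le_lt_trans (LS_setT_lty F).
  by apply: le_measure; rewrite ?inE.
- by apply: measurable_funS (continuous_measurable_fun cg).
- have /compact_bounded[N [Nr gN']] := continuous_compact
    (continuous_subspaceT cg) (@segment_compact R (- M) M).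
  by exists N; split=> // y Ny x xM; apply: gN' => //; exists x.
Qed.

(** Fubini for the indicator of x <= y moves the integration from dF to
Lebesgue measure. There is no boundary term since g vanishes at both ends.
On the right-hand side, almost everywhere convergence of distribution
functions is enough to pass to the limit. *)
Lemma Rintegral_by_parts F :
  \int[LS F]_x (g x * \1_(`[- M, M]%classic) x) =
  - \int[mu]_y (F y * (gd y * \1_(`[- M, M]%classic) y)).
Proof.
pose h (z : measurableTypeR R * measurableTypeR R) : R :=
  (((z.1 : R) <= (z.2 : R))%R : bool)%:R.
have mh : measurable_fun setT h.
  have -> : h = \1_[set z : measurableTypeR R * measurableTypeR R | z.1 <= z.2].
    apply/funext => z; rewrite /h indicE; congr (nat_of_bool _)%:R.
    by apply/idP/idP => [H|/set_mem//]; exact/mem_set.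
  apply: measurable_indic.
  have -> : [set z : measurableTypeR R * measurableTypeR R | z.1 <= z.2] =
      (fun z => z.2 - z.1) @^-1` `[0, +oo[.
    by apply/seteqP; split => z /=; rewrite in_itv/= andbT subr_ge0.
  rewrite -[X in measurable X]setTI.
  have : measurable_fun setT (fun z : measurableTypeR R * measurableTypeR R => z.2 - z.1).
    by apply: measurable_funB; [exact: measurable_snd|exact: measurable_fst].
  by apply => //; exact: measurable_itv.
have h1 z : `|h z| <= 1 by rewrite /h normr_nat lern1 leq_b1.
have E := bounded_Fubini (LS F) mh h1 integrable_derive_indic.
transitivity (- \int[LS F]_x \int[mu]_y (h (x, y) * k y)).
  rewrite -[LHS]opprK; congr (- _).
  transitivity (-1 * \int[LS F]_x (g x * \1_(`[- M, M]%classic) x)); first by rewrite mulN1r.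
  rewrite -(RintegralZl (-1) measurableT); last exact: integrable_mul_indic.
  apply: eq_Rintegral => x _; rewrite mulN1r -Rintegral_indic_derive.
  apply: eq_Rintegral => y _; congr (_ * _).
  by rewrite /h indicE mem_setE in_itv/= andbT.
rewrite E; congr (- _); apply: eq_Rintegral => y _; congr (_ * _).
rewrite -Rintegral_indic_itvNyc; apply: eq_Rintegral => x _.
by rewrite /h indicE mem_setE in_itv/=.
Qed.

End IntegrationByParts.

End WeakLimit.

(** * Continuity theorem *)

Section LevyContinuity.
Context {R : realType}.
Notation mu := (@lebesgue_measure R).
Notation LS := lebesgue_stieltjes_measure.
Implicit Types F : distribution_function R.

Definition cauchy_mean F (s : R) : R := \int[LS F]_x (1 + (s * x) ^+ 2)^-1.

Lemma oneDsqr_gt0 (y : R) : 0 < 1 + y ^+ 2.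
Proof. by rewrite ltr_pwDl// sqr_ge0. Qed.

Lemma cauchy_kernel_le1 (y : R) : `|(1 + y ^+ 2)^-1| <= 1.
Proof.
by rewrite ger0_norm ?invr_ge0 ?addr_ge0 ?sqr_ge0// invf_le1 ?oneDsqr_gt0// lerDl sqr_ge0.
Qed.

Lemma continuous_cauchy_kernel (s : R) : continuous (fun x => (1 + (s * x) ^+ 2)^-1).
Proof.
move=> x; apply: cvgV; first by rewrite gt_eqF// oneDsqr_gt0.
apply: cvgD; first exact: cvg_cst.
apply: (@continuous_comp _ _ _ (fun x : R => s * x) (fun y : R => y ^+ 2)).
  exact: mulrl_continuous.
exact: exprn_continuous.
Qed.

Lemma measurable_cauchy_kernel (s : R) :
  measurable_fun setT (fun x : measurableTypeR R => (1 + (s * x) ^+ 2)^-1).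
Proof. by apply: continuous_measurable_fun; exact: continuous_cauchy_kernel. Qed.

Lemma cauchy_meanE F s : cauchy_mean F s =
  \int[mu]_r (complex.Re (charfun F (s * r)) * exponential_pdf 1 r).
Proof.
transitivity (\int[LS F]_x (1 + (s * (x - 0)) ^+ 2)^-1).
  by apply: eq_Rintegral => x _; rewrite subr0.
rewrite (cauchy_transform F s 0); apply: eq_Rintegral => r _.
by rewrite mulr0 mul0r cos0 sin0 mul1r mul0r addr0.
Qed.

Lemma cauchy_mean_integrable F s :
  (LS F).-integrable setT (EFin \o (fun x => (1 + (s * x) ^+ 2)^-1)).
Proof.
exact: (bounded_integrable (LS_setT_lty F) (measurable_cauchy_kernel s)
  (fun x => cauchy_kernel_le1 _)).
Qed.

Lemma Re_charfun_le1 F t : `|complex.Re (charfun F t)| <= 1.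
Proof.
rewrite Re_charfun; apply: le_trans (bounded_le_Rintegral (LS_setT_lty F) _ _) _.
- by apply: continuous_measurable_fun; exact: (continuous_cosM t).
- by move=> x; exact: cos_max.
- by rewrite mul1r -[X in _ <= X]/(fine 1%E) le_eqVlt -(probability_setT (LS F)) eqxx.
Qed.

Lemma continuous_Re_charfun F : continuous (fun t => complex.Re (charfun F t)).
Proof.
move=> t; apply/(@cvg_nbhsP _ R^o) => u ut.
rewrite (_ : (fun n => _) = fun n => \int[LS F]_x cos (u n * x)); last first.
  by apply/funext => n; rewrite Re_charfun.
rewrite Re_charfun; apply: (bounded_dominated_cvg (LS_setT_lty F) (M := 1)).
- by move=> n; apply: continuous_measurable_fun; exact: (continuous_cosM (u n)).
- by move=> n x; exact: cos_max.
- move=> x; apply: (cvg_comp (fun n => u n * x) cos); last exact: continuous_cos.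
  by apply: cvgMr_tmp.
Qed.

Lemma square_le_cauchy (v : R) : 0 <= v -> Num.min 1 v <= 2 * (1 - (1 + v)^-1).
Proof.
move=> v0; have v1 : 0 < 1 + v by rewrite ltr_pwDl.
rewrite (_ : 1 - (1 + v)^-1 = v / (1 + v)); last by field; rewrite gt_eqF.
rewrite mulrA ler_pdivlMr//; by have [h|h] := leP 1 v; nra.
Qed.

Lemma mem_symm_itv (s x : R) : 0 < s ->
  (x \in `[- s^-1, s^-1]) = ((s * x) ^+ 2 <= 1).
Proof.
move=> s0; rewrite in_itv/= -ler_norml -[X in _ = (_ <= X)](expr1n _ 2).
rewrite -[X in _ = (X <= _)]real_normK ?num_real//.
rewrite ler_pXn2r ?nnegrE// normrM (gtr0_norm s0).
by rewrite -ler_pdivlMl// mulr1.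
Qed.

(** Multiplication of c by the clipped parabola, the positive part of
1 - (s x)^2, changes c by at most min(1, (s x)^2), and this is controlled by
the gap between 1 and the Cauchy kernel. The clipped parabola vanishes at the
ends of its support, as integration by parts requires. *)
Lemma truncation_bound (s x c : R) : `|c| <= 1 -> 0 < s ->
  `|c - c * (1 - (s * x) ^+ 2) * \1_(`[- s^-1, s^-1]%classic) x| <=
  2 * (1 - (1 + (s * x) ^+ 2)^-1).
Proof.
move=> c1 s0; apply: le_trans (square_le_cauchy (sqr_ge0 (s * x))).
rewrite indicE mem_setE mem_symm_itv//.
have v0 := sqr_ge0 (s * x).
have [v1|v1] := leP ((s * x) ^+ 2) 1.
  rewrite mulr1 (_ : c - _ = c * (s * x) ^+ 2); last by ring.
  by rewrite normrM (ger0_norm v0) ler_piMl.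
by rewrite mulr0 subr0.
Qed.

Lemma cauchy_tail (s x : R) : 0 < s ->
  \1_(`]-oo, - s^-1]%classic) x + 1 - \1_(`]-oo, s^-1]%classic) x <=
  2 * (1 - (1 + (s * x) ^+ 2)^-1).
Proof.
move=> s0; apply: le_trans (square_le_cauchy (sqr_ge0 (s * x))).
rewrite !indicE !mem_setE !in_itv/=.
have v0 := sqr_ge0 (s * x).
have si : s * s^-1 = 1 by rewrite divff// gt_eqF.
rewrite -(ler_pM2l s0 x (- s^-1)) -(ler_pM2l s0 x s^-1) mulrN si le_min.
move: (s * x) v0 => y v0.
by have [h1|h1] := leP y (-1); have [h2|h2] := leP y 1;
  rewrite /= ?mulr0n ?mulr1n; apply/andP; split; nra.
Qed.

Lemma integrable_cauchy_gap F s :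
  (LS F).-integrable setT (EFin \o (fun x => 2 * (1 - (1 + (s * x) ^+ 2)^-1))).
Proof.
have i1 : (LS F).-integrable setT (EFin \o cst (1 : R)).
  exact: finite_measure_integrable_cst.
exact: (integrable_ZlR 2 (integrableB measurableT i1 (cauchy_mean_integrable F s))).
Qed.

Lemma Rintegral_cauchy_gap F s :
  \int[LS F]_x (2 * (1 - (1 + (s * x) ^+ 2)^-1)) = 2 * (1 - cauchy_mean F s).
Proof.
have i1 : (LS F).-integrable setT (EFin \o cst (1 : R)).
  exact: finite_measure_integrable_cst.
have iK := cauchy_mean_integrable F s.
rewrite (RintegralZl 2 measurableT (integrableB measurableT i1 iK)).
by rewrite (RintegralB measurableT i1 iK) Rintegral_cst_LS.
Qed.

(** Off ]-1/s, 1/s] the Cauchy kernel is at most 1/2, so a Cauchy mean close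
to 1 forces the tails to be small. *)
Lemma distribution_tail F s : 0 < s ->
  F (- s^-1) + 1 - F (s^-1) <= 2 * (1 - cauchy_mean F s).
Proof.
move=> s0.
have iI y : (LS F).-integrable setT (EFin \o \1_(`]-oo, y]%classic)).
  exact: integrable_indic.
have i1 : (LS F).-integrable setT (EFin \o cst (1 : R)).
  exact: finite_measure_integrable_cst.
have iA := integrable_addR (iI (- s^-1)) i1.
rewrite -(Rintegral_indic_itvNyc F (- s^-1)) -(Rintegral_indic_itvNyc F (s^-1)).
rewrite -[X in _ + X - _](Rintegral_cst_LS F) -(RintegralD measurableT (iI _) i1).
rewrite -(RintegralB measurableT iA (iI _)) -Rintegral_cauchy_gap.
apply: (le_Rintegral measurableT (integrableB measurableT iA (iI _))).
  exact: integrable_cauchy_gap.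
by move=> x _; exact: cauchy_tail.
Qed.

Section ContinuityTheorem.
Context (F_ : nat -> distribution_function R) (phi : R -> R[i]).
Hypothesis Re_cvg : forall t,
  complex.Re (charfun (F_ n) t) @[n --> \oo] --> complex.Re (phi t).
Hypothesis Im_cvg : forall t,
  complex.Im (charfun (F_ n) t) @[n --> \oo] --> complex.Im (phi t).
Hypothesis Re_cont0 : complex.Re (phi t) @[t --> (0 : R)] --> (1 : R).

Let C (s : R) := \int[mu]_r (complex.Re (phi (s * r)) * exponential_pdf 1 r).

Let mpdf : measurable_fun setT (exponential_pdf (1 : R)).
Proof. exact: measurable_exponential_pdf. Qed.

Let measurable_Re_charfun F (s : R) :
  measurable_fun setT (fun r : R => complex.Re (charfun F (s * r))).
Proof.
apply: continuous_measurable_fun => r.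
apply: (@continuous_comp _ _ _ (fun r : R => s * r) (fun t => complex.Re (charfun F t))).
  exact: mulrl_continuous.
exact: continuous_Re_charfun.
Qed.

Let measurable_Re_phi (s : R) : measurable_fun setT (fun r : R => complex.Re (phi (s * r))).
Proof.
by apply: (measurable_fun_cvg (h := fun n r => complex.Re (charfun (F_ n) (s * r)))).
Qed.

Let Re_phi_le1 t : `|complex.Re (phi t)| <= 1.
Proof.
apply: (cvgr_to_le (cvg_norm (@Re_cvg t))); apply: nearW => n; exact: Re_charfun_le1.
Qed.

Let pdf_bound (a r : R) : `|a| <= 1 -> `|a * exponential_pdf 1 r| <= exponential_pdf 1 r.
Proof.
move=> a1; rewrite normrM [X in _ * X]ger0_norm ?exponential_pdf_ge0//.
by rewrite ler_piMl ?exponential_pdf_ge0.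
Qed.

Let cauchy_mean_cvg s : cauchy_mean (F_ n) s @[n --> \oo] --> C s.
Proof.
rewrite (_ : (fun n => _) = fun n => \int[mu]_r (complex.Re (charfun (F_ n) (s * r)) *
    exponential_pdf 1 r)); last by apply/funext => n; exact: cauchy_meanE.
apply: (@Rintegral_dominated_cvg _ _ R mu _ _ (exponential_pdf 1)).
- by move=> n; apply: measurable_funM; [exact: measurable_Re_charfun|exact: mpdf].
- by apply: measurable_funM; [exact: measurable_Re_phi|exact: mpdf].
- by apply: aeW => r; apply: cvgM; [exact: Re_cvg|exact: cvg_cst].
- exact: integrable_exponential_pdf.
- by move=> n r; apply: pdf_bound; exact: Re_charfun_le1.
Qed.

Let C_cvg : C (m.+1%:R^-1) @[m --> \oo] --> (1 : R).
Proof.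
have I1 : \int[mu]_r (1 * exponential_pdf (1 : R) r) = 1.
  rewrite /Rintegral; under eq_integral do rewrite mul1r.
  by rewrite integral_exponential_pdf.
rewrite -[X in _ --> X]I1.
apply: (@Rintegral_dominated_cvg _ _ R mu _ _ (exponential_pdf 1)).
- by move=> n; apply: measurable_funM; [exact: measurable_Re_phi|exact: mpdf].
- by apply: measurable_funM; [exact: measurable_cst|exact: mpdf].
- apply: aeW => r; apply: cvgM; last exact: cvg_cst.
  have h : n.+1%:R^-1 * r @[n --> \oo] --> (0 : R).
    rewrite -[X in _ --> X](mul0r r); apply: cvgM; last exact: cvg_cst.
    exact: cvg_harmonic.
  exact: (cvg_comp (fun n : nat => n.+1%:R^-1 * r) (fun t => complex.Re (phi t)) h
    (@Re_cont0)).
- exact: integrable_exponential_pdf.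
- by move=> n r; apply: pdf_bound; exact: Re_phi_le1.
Qed.

(** Cauchy means depend on characteristic functions only and converge with
them; their limit C s tends to 1 as s tends to 0 since Re phi tends to 1
at 0. Through the tail bound this is tightness, so a Helly limit F is a
distribution function. To identify its characteristic function, a cosine or
sine c is replaced by its product with a clipped parabola, at a cost measured
by Cauchy means uniformly along the sequence, and the product is integrated
by parts. *)
Theorem levy_continuity : exists F : distribution_function R, charfun F =1 phi.
Proof.
have ndF_ n : nondecreasing (F_ n) by exact: cumulative_is_nondecreasing.
have F01 n x : 0 <= F_ n x <= 1.
  by rewrite distribution_function_ge0 distribution_function_le1.
have [k [F [koo ndF rcF F_01 Fq]]] := helly ndF_ F01.
have sub_cauchy_cvg s : 2 * (1 - cauchy_mean (F_ (k n)) s) @[n --> \oo] --> 2 * (1 - C s).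
  apply: cvgM; first exact: cvg_cst.
  apply: cvgB; first exact: cvg_cst.
  exact: (cvg_comp k (fun n => cauchy_mean (F_ n) s) koo (@cauchy_mean_cvg s)).
(* The tail bound is passed to the limit at points q and q' of convergence;
moving from m + 1 to m + 2 leaves room for them. *)
have tail m : F (- m.+2%:R) + 1 - F m.+2%:R <= 2 * (1 - C (m.+1%:R^-1)).
  have [q [l [/andP[_ qm] /andP[Fl _] ql]]] : exists q l : R, [/\ - m.+2%:R < q < - m.+1%:R,
      F (- m.+2%:R) <= l <= F (- m.+1%:R) & F_ (k n) q @[n --> \oo] --> l].
    by apply: Fq; rewrite ltrN2 ltr_nat.
  have [q' [l' [/andP[mq' _] /andP[_ lF] ql']]] : exists q l : R, [/\ m.+1%:R < q < m.+2%:R,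
      F m.+1%:R <= l <= F m.+2%:R & F_ (k n) q @[n --> \oo] --> l].
    by apply: Fq; rewrite ltr_nat.
  have s0 : 0 < m.+1%:R^-1 :> R by rewrite invr_gt0.
  apply: (@le_trans _ _ (l + 1 - l')); first by lra.
  have L1 : F_ (k n) q + 1 - F_ (k n) q' @[n --> \oo] --> l + 1 - l'.
    by apply: cvgB => //; apply: cvgD => //; exact: cvg_cst.
  apply: (ler_cvg_to L1 (sub_cauchy_cvg (m.+1%:R^-1))); apply: nearW => n.
  apply: le_trans (distribution_tail (F_ (k n)) s0); rewrite invrK.
  have := ndF_ (k n) _ _ (ltW qm); have := ndF_ (k n) _ _ (ltW mq'); lra.
have tail0 : 2 * (1 - C (m.+1%:R^-1)) @[m --> \oo] --> (0 : R).
  rewrite -(mulr0 2) -(subrr 1); apply: cvgM; first exact: cvg_cst.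
  by apply: cvgB; [exact: cvg_cst|exact: C_cvg].
have lim0 : F @ -oo --> (0 : R).
  apply/cvgrPdist_lt => e e0.
  have [m me] : exists m : nat, 2 * (1 - C (m.+1%:R^-1)) < e.
    by apply: (@filter_ex _ \oo); exact: (cvgr_lt _ tail0).
  near=> x; have xm : x <= - m.+2%:R by near: x; exact: nbhs_ninfty_le.
  have := ndF _ _ xm; have := tail m.
  have /andP[x0 _] := F_01 x; have /andP[_ m1] := F_01 m.+2%:R.
  by rewrite sub0r normrN ger0_norm//; lra.
have lim1 : F @ +oo --> (1 : R).
  apply/cvgrPdist_lt => e e0.
  have [m me] : exists m : nat, 2 * (1 - C (m.+1%:R^-1)) < e.
    by apply: (@filter_ex _ \oo); exact: (cvgr_lt _ tail0).
  near=> x; have xm : m.+2%:R <= x by near: x; exact: nbhs_pinfty_ge.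
  have := ndF _ _ xm; have := tail m.
  have /andP[_ x1] := F_01 x; have /andP[m0 _] := F_01 (- m.+2%:R).
  by rewrite ger0_norm ?subr_ge0//; lra.
pose G : distribution_function R := HB.pack F (isCumulative.Build R _ R F ndF rcF)
  (isCumulativeBounded.Build R 0 1 F lim0 lim1).
have Fcvg := helly_ae_cvg (fun n => ndF_ (k n)) ndF rcF Fq.
exists G => t.
(* The limit of the means of c along the sequence is the mean of c for G:
both are limits, as m grows, of A G m. *)
have main (c cd : R -> R) (l : R) : (forall x, is_derive (x : R) (1 : R) c (cd x)) ->
    continuous cd -> (forall x, `|c x| <= 1) ->
    \int[LS (F_ n)]_x c x @[n --> \oo] --> l -> \int[LS G]_x c x = l.
  move=> dc ccd c1 cl.
  (* The product with the parabola of half-width m + 1, before clipping, and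
  its derivative. *)
  pose g m x := c x * (1 - (m.+1%:R^-1 * x) ^+ 2).
  pose gd m x := cd x * (1 - (m.+1%:R^-1 * x) ^+ 2) - c x * (2 * m.+1%:R^-1 ^+ 2 * x).
  have dg m (x : R) : is_derive (x : R) (1 : R) (g m) (gd m x).
    have := dc x => ?.
    apply: is_derive_eq; rewrite /GRing.scale/= /gd; ring.
  have cc := continuous_is_derive dc.
  have csq m : continuous (fun x : R => (m.+1%:R^-1 * x) ^+ 2).
    move=> x; apply: (@continuous_comp _ _ _ (fun x : R => m.+1%:R^-1 * x) (fun y : R => y ^+ 2)).
      exact: mulrl_continuous.
    exact: exprn_continuous.
  have cgd m : continuous (gd m).
    move=> x; apply: cvgB; apply: cvgM.
    - exact: ccd.
    - by apply: cvgB; [exact: cvg_cst|exact: csq].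
    - exact: cc.
    - exact: mulrl_continuous.
  have s0 m : 0 < m.+1%:R^-1 :> R by rewrite invr_gt0.
  have M0 m : 0 <= m.+1%:R :> R by [].
  have gM m : g m m.+1%:R = 0 by rewrite /g mulVf ?pnatr_eq0// expr1n subrr mulr0.
  have gN m : g m (- m.+1%:R) = 0.
    by rewrite /g mulrN mulVf ?pnatr_eq0// sqrrN expr1n subrr mulr0.
  pose A (H : distribution_function R) m :=
    \int[LS H]_x (g m x * \1_(`[- m.+1%:R, m.+1%:R]%classic) x).
  have A_cvg m : A (F_ (k n)) m @[n --> \oo] --> A G m.
    pose w y : R := gd m y * \1_(`[- m.+1%:R, m.+1%:R]%classic) y.
    have iw : mu.-integrable setT (EFin \o w) by exact: integrable_derive_indic.
    have mw : measurable_fun setT w by apply/measurable_EFinP; exact: measurable_int iw.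
    have AE H : A H m = - \int[mu]_y (H y * w y).
      exact: (Rintegral_by_parts (M0 m) (dg m) (cgd m) (gN m) (gM m) H).
    rewrite AE (_ : (fun n => _) = fun n => - \int[mu]_y (F_ (k n) y * w y)); last first.
      by apply/funext => n; exact: AE.
    apply: cvgN; apply: (@Rintegral_dominated_cvg _ _ R mu _ _ (fun y => `|w y|)).
    - by move=> n; apply: measurable_funM => //; exact: measurable_distribution_function.
    - by apply: measurable_funM => //; exact: measurable_distribution_function.
    - have [N [mN N0 sN]] := Fcvg.
      exists N; split => // y ny; apply: sN => cy; apply: ny.
      by apply: cvgM; [exact: cy|exact: cvg_cst].
    - exact: integrable_norm.
    - move=> n y; have /andP[F0 F1] := F01 (k n) y.
      by rewrite normrM ger0_norm// ler_piMl.
  have ic (H : distribution_function R) : (LS H).-integrable setT (EFin \o c).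
    exact: (bounded_integrable (LS_setT_lty H) (continuous_measurable_fun cc) c1).
  have A_dist (H : distribution_function R) m :
      `|\int[LS H]_x c x - A H m| <= 2 * (1 - cauchy_mean H m.+1%:R^-1).
    have ig := integrable_mul_indic m.+1%:R (dg m) H.
    have icg := integrableB measurableT (ic H) ig.
    rewrite -(RintegralB measurableT (ic H) ig) -Rintegral_cauchy_gap.
    apply: le_trans (le_normr_Rintegral measurableT icg) _.
    apply: (le_Rintegral measurableT (integrable_norm icg) (integrable_cauchy_gap _ _)).
    by move=> x _; have := truncation_bound x (c1 x) (s0 m); rewrite invrK.
  have l_dist m : `|l - A G m| <= 2 * (1 - C m.+1%:R^-1).
    have ck : \int[LS (F_ (k n))]_x c x @[n --> \oo] --> l.
      exact: (cvg_comp k (fun n => \int[LS (F_ n)]_x c x) koo cl).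
    apply: (ler_cvg_to (cvg_norm (cvgB ck (A_cvg m))) (sub_cauchy_cvg m.+1%:R^-1)).
    by apply: nearW => n; exact: A_dist.
  have G_cauchy : 2 * (1 - cauchy_mean G m.+1%:R^-1) @[m --> \oo] --> (0 : R).
    rewrite -(mulr0 2) -(subrr 1); apply: cvgM; first exact: cvg_cst.
    apply: cvgB; first exact: cvg_cst.
    rewrite -[X in _ --> X](Rintegral_cst_LS G 1).
    apply: (bounded_dominated_cvg (LS_setT_lty G) (M := 1)).
    - by move=> n; exact: measurable_cauchy_kernel.
    - by move=> n x; exact: cauchy_kernel_le1.
    - move=> x.
      have h : (1 + (m.+1%:R^-1 * x) ^+ 2)^-1 @[m --> \oo] --> (1 + (0 * x) ^+ 2)^-1.
        apply: cvgV; first by rewrite gt_eqF// oneDsqr_gt0.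
        apply: cvgD; first exact: cvg_cst.
        apply: (cvg_comp (fun m : nat => m.+1%:R^-1 * x) (fun y : R => y ^+ 2)).
          by apply: cvgM; [exact: cvg_harmonic|exact: cvg_cst].
        exact: exprn_continuous.
      by rewrite mul0r expr0n/= addr0 invr1 in h.
  have lim_l : A G m @[m --> \oo] --> l.
    apply/cvgrPdist_le => e e0; near=> m; apply: le_trans (l_dist m) _.
    by near: m; exact: (cvgr_le _ tail0).
  have lim_G : A G m @[m --> \oo] --> \int[LS G]_x c x.
    apply/cvgrPdist_le => e e0; near=> m; apply: le_trans (A_dist G m) _.
    by near: m; exact: (cvgr_le _ G_cauchy).
  exact: (cvg_unique _ lim_G lim_l).
rewrite charfunE; apply/eqP; rewrite eq_complex/=; apply/andP; split; apply/eqP.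
- apply: (main (fun x => cos (t * x)) (fun x => - t * sin (t * x))).
  + move=> x; apply: is_derive_eq; rewrite /GRing.scale/=; ring.
  + by move=> x; apply: cvgM; [exact: cvg_cst|exact: continuous_sinM].
  + by move=> x; exact: cos_max.
  + by rewrite (_ : (fun n => _) = fun n => complex.Re (charfun (F_ n) t))//;
      apply/funext => n; rewrite Re_charfun.
- apply: (main (fun x => sin (t * x)) (fun x => t * cos (t * x))).
  + move=> x; apply: is_derive_eq; rewrite /GRing.scale/=; ring.
  + by move=> x; apply: cvgM; [exact: cvg_cst|exact: continuous_cosM].
  + by move=> x; exact: sin_max.
  + by rewrite (_ : (fun n => _) = fun n => complex.Im (charfun (F_ n) t))//;
      apply/funext => n; rewrite Im_charfun.
Unshelve. all: by end_near.
Qed.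

End ContinuityTheorem.

End LevyContinuity.

(** * Complex exponentials and compound Poisson laws *)

Section ComplexExponential.
Context {R : realType}.
Implicit Types z w : R[i].

Lemma complexP z w : complex.Re z = complex.Re w -> complex.Im z = complex.Im w -> z = w.
Proof. by case: z => a b; case: w => c d /= -> ->. Qed.

Lemma Re_add z w : complex.Re (z + w) = complex.Re z + complex.Re w.
Proof. by case: z; case: w. Qed.

Lemma Im_add z w : complex.Im (z + w) = complex.Im z + complex.Im w.
Proof. by case: z; case: w. Qed.

Lemma Re_conj z : complex.Re (conjc z) = complex.Re z.
Proof. by case: z. Qed.

Lemma Im_conj z : complex.Im (conjc z) = - complex.Im z.
Proof. by case: z. Qed.

Lemma Re_expC z : complex.Re (expC z) = expR (complex.Re z) * cos (complex.Im z).
Proof. by rewrite /= mul0r subr0. Qed.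

Lemma Im_expC z : complex.Im (expC z) = expR (complex.Re z) * sin (complex.Im z).
Proof. by rewrite /= mul0r addr0. Qed.

Lemma expC0 : expC 0 = 1 :> R[i].
Proof. by apply: complexP; rewrite ?Re_expC ?Im_expC/= expR0 mul1r ?cos0 ?sin0. Qed.

Lemma expCD z w : expC (z + w) = expC z * expC w.
Proof.
case: z => a b; case: w => c d.
apply: complexP; rewrite /= expRD ?cosD ?sinD; ring.
Qed.

Lemma Re_sum (I : Type) (r : seq I) (P : pred I) (F : I -> R[i]) :
  complex.Re (\sum_(i <- r | P i) F i) = \sum_(i <- r | P i) complex.Re (F i).
Proof. by apply: (big_morph (@complex.Re R)) => // [[? ?] [? ?]]. Qed.

Lemma Im_sum (I : Type) (r : seq I) (P : pred I) (F : I -> R[i]) :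
  complex.Im (\sum_(i <- r | P i) F i) = \sum_(i <- r | P i) complex.Im (F i).
Proof. by apply: (big_morph (@complex.Im R)) => // [[? ?] [? ?]]. Qed.

Lemma mulrn_real z n : z *+ n = (n%:R : R)%:C * z.
Proof.
elim: n => [|n IH]; first by rewrite mulr0n rmorph0 mul0r.
by rewrite mulrSr IH -natr1 rmorphD/= rmorph1 mulrDl mul1r.
Qed.

Lemma expCMn z n : expC (z *+ n) = expC z ^+ n.
Proof. by elim: n => [|n IH]; rewrite ?mulr0n ?expC0// mulrS exprS expCD IH. Qed.

Lemma modulusM z w : modulus (z * w) = modulus z * modulus w.
Proof. exact: ComplexField.Normc.normcM. Qed.

Lemma modulusD z w : modulus (z + w) <= modulus z + modulus w.
Proof. exact: le_normcD. Qed.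

Lemma modulus_ge0 z : 0 <= modulus z.
Proof. by case: z => a b; exact: sqrtr_ge0. Qed.

Lemma modulus_real (a : R) : modulus a%:C = `|a|.
Proof. by rewrite /modulus/= expr0n/= addr0 sqrtr_sqr. Qed.

Lemma modulus_expC z : modulus (expC z) = expR (complex.Re z).
Proof.
rewrite modulusM modulus_real ger0_norm ?expR_ge0// /modulus/=.
by rewrite cos2Dsin2 sqrtr1 mulr1.
Qed.

Lemma modulus_sqr z : modulus z ^+ 2 = complex.Re z ^+ 2 + complex.Im z ^+ 2.
Proof. by case: z => a b; rewrite /modulus/= sqr_sqrtr// addr_ge0 ?sqr_ge0. Qed.

Lemma Re_le_modulus z : `|complex.Re z| <= modulus z.
Proof.
rewrite -(ger0_norm (modulus_ge0 z)) -ler_sqr ?nnegrE//.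
by rewrite !real_normK ?num_real// modulus_sqr lerDl sqr_ge0.
Qed.

Lemma Im_le_modulus z : `|complex.Im z| <= modulus z.
Proof.
rewrite -(ger0_norm (modulus_ge0 z)) -ler_sqr ?nnegrE//.
by rewrite !real_normK ?num_real// modulus_sqr lerDr sqr_ge0.
Qed.

Lemma modulus_le_ReIm z : modulus z <= `|complex.Re z| + `|complex.Im z|.
Proof.
rewrite -(ger0_norm (modulus_ge0 z)) -[leRHS]ger0_norm ?addr_ge0// -ler_sqr ?nnegrE//.
rewrite !real_normK ?num_real ?modulus_sqr//.
by rewrite sqrrD !real_normK ?num_real// lerD2r lerDl mulrn_wge0 ?mulr_ge0.
Qed.

(** Telescoping: the difference of n-th powers is a sum of n differences
z - w multiplied by powers of modulus at most 1. *)
Lemma modulus_expX_sub z w n : modulus z <= 1 -> modulus w <= 1 ->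
  modulus (z ^+ n - w ^+ n) <= n%:R * modulus (z - w).
Proof.
move=> z1 w1; elim: n => [|n IH]; first by rewrite !expr0 subrr mul0r (modulus_real 0) normr0.
have wn1 : modulus (w ^+ n) <= 1.
  elim: n {IH} => [|n IH]; first by rewrite expr0 (modulus_real 1) normr1.
  by rewrite exprS modulusM mulr_ile1// modulus_ge0.
rewrite (_ : _ - _ = z * (z ^+ n - w ^+ n) + (z - w) * w ^+ n); last by rewrite !exprS; ring.
apply: le_trans (modulusD _ _) _; rewrite !modulusM mulrSr mulrDl mul1r lerD//.
  by apply: le_trans IH; rewrite ler_piMl ?modulus_ge0.
by rewrite ler_piMr ?modulus_ge0.
Qed.

End ComplexExponential.

Section PoissonLimit.
Context {R : realType}.

(** The offset m serves the Poisson approximation, where a fixed intensity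
divided by (n + m).+1 has to be a probability for every n. *)
Lemma is_derive0_harmonic (U : R -> R) (d : R) (m : nat) :
  is_derive (0 : R) (1 : R) U d ->
  (n + m).+1%:R * (U ((n + m).+1%:R^-1) - U 0) @[n --> \oo] --> d.
Proof.
move=> [dU <-].
have H : h^-1 *: (U (h *: 1 + 0) - U 0) @[h --> 0^'] --> 'D_1 U 0 by exact: dU.
have c : (n + m).+1%:R^-1 @[n --> \oo] --> (0 : R)^'.
  have h : (n + m).+1%:R^-1 @[n --> \oo] --> (0 : R).
    by have := @cvg_harmonic R; rewrite -(cvg_shiftn m).
  move=> A A0; apply: (@filterS _ \oo _ _ _ _ (h _ A0)) => n /=; apply.
  by have : (n + m).+1%:R^-1 != 0 :> R by rewrite invr_eq0 pnatr_eq0.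
have := cvg_comp _ _ c H.
apply: cvg_trans; apply: near_eq_cvg; near=> n => /=.
by rewrite invrK addr0 /GRing.scale/= mulr1.
Unshelve. all: by end_near.
Qed.

(** 1 + a/N and exp (a/N) have the same value and derivative at 1/N = 0, so
they differ by o(1/N), and their N-th powers have the same limit. *)
Lemma expC_linear_error (a : R[i]) (m : nat) :
  (n + m).+1%:R * modulus (1 + ((n + m).+1%:R^-1)%:C * a -
     expC (((n + m).+1%:R^-1)%:C * a)) @[n --> \oo] --> (0 : R).
Proof.
case: a => p q.
have dU : is_derive (0 : R) (1 : R) (fun s => expR (s * p) * cos (s * q)) p.
  apply: is_derive_eq; rewrite !mul0r expR0 cos0 sin0 /GRing.scale/=; ring.
have dV : is_derive (0 : R) (1 : R) (fun s => expR (s * p) * sin (s * q)) q.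
  apply: is_derive_eq; rewrite !mul0r expR0 cos0 sin0 /GRing.scale/=; ring.
have cU := is_derive0_harmonic m dU; have cV := is_derive0_harmonic m dV.
have bound : `|p - (n + m).+1%:R * (expR ((n + m).+1%:R^-1 * p) *
        cos ((n + m).+1%:R^-1 * q) - expR (0 * p) * cos (0 * q))| +
      `|q - (n + m).+1%:R * (expR ((n + m).+1%:R^-1 * p) *
        sin ((n + m).+1%:R^-1 * q) - expR (0 * p) * sin (0 * q))|
    @[n --> \oo] --> (0 : R).
  have c0 : `|p - p| + `|q - q| = 0 :> R by rewrite !subrr normr0 addr0.
  rewrite -[X in _ --> X]c0; apply: cvgD; apply: cvg_norm; apply: cvgB.
  - exact: cvg_cst.
  - exact: cU.
  - exact: cvg_cst.
  - exact: cV.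
apply: (squeeze_cvgr _ (cvg_cst 0) bound); near=> n.
rewrite mulr_ge0 ?modulus_ge0// andTb.
have N0 : 0 < (n + m).+1%:R :> R by [].
move: ((n + m).+1%:R) N0 => N N0.
have E (v : R[i]) : N * modulus v = modulus (N%:C * v).
  by rewrite modulusM modulus_real ger0_norm// ltW.
rewrite E.
apply: le_trans (modulus_le_ReIm _) _.
rewrite /= !mul0r expR0 cos0 sin0 !subr0 ?addr0 ?mulr0 ?mul1r.
have NN : N * N^-1 = 1 by rewrite mulfV// gt_eqF.
rewrite le_eqVlt; apply/orP; left; apply/eqP; congr (_ + _); apply: congr1.
- by rewrite mulrBr mulrDr mulrA NN; ring.
- by rewrite mulrBr add0r mulrA NN; ring.
Unshelve. all: by end_near.
Qed.

End PoissonLimit.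

Section CharacteristicFunctions.
Context {R : realType}.
Implicit Types (phi : R -> R[i]) (b l p t : R).

Definition is_charfun phi := exists F : distribution_function R, charfun F =1 phi.

Lemma eq_is_charfun phi psi : phi =1 psi -> is_charfun phi -> is_charfun psi.
Proof. by move=> e [F Fphi]; exists F => t; rewrite Fphi e. Qed.

Lemma is_charfunM phi psi : is_charfun phi -> is_charfun psi ->
  is_charfun (fun t => phi t * psi t).
Proof.
move=> [F Fphi] [H Hpsi]; have [L [_ LE]] := convolution_distribution F H.
by exists L => t; rewrite LE Fphi Hpsi.
Qed.

Lemma is_charfun_two_point p b : 0 <= p <= 1 ->
  is_charfun (fun t => 1 + p%:C * (expC (0 +i* (t * b)) - 1)).
Proof.
move=> p01.
pose X (e : bool) : R := if e then b else 0.
have mX : measurable_fun setT X by [].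
have [F [_ FE]] := exists_distribution (bernoulli_prob p) mX.
exists F => t; rewrite FE.
have E (g : R -> R) : (forall x, `|g x| <= 1) ->
    \int[bernoulli_prob p]_e g (t * X e) = p * g (t * b) + (1 - p) * g 0.
  move=> g1.
  have bfin : (bernoulli_prob p setT < +oo)%E by rewrite probability_setT ltry.
  have ib (h : bool -> R) : (bernoulli_prob p).-integrable setT (EFin \o h).
    apply: (bounded_integrable bfin (M := `|h true| + `|h false|)) => //.
    by case; rewrite ?lerDl ?lerDr.
  (* The formula for Bernoulli integrals is for nonnegative functions, whence
  the shift by 1. *)
  have : \int[bernoulli_prob p]_e (g (t * X e) + 1) = p * g (t * b) + (1 - p) * g 0 + 1.
    rewrite /Rintegral integral_bernoulli_prob//.
      transitivity (p * (g (t * b) + 1) + (1 - p) * (g (t * 0) + 1)) => //.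
      by rewrite mulr0; ring.
    by move=> e; rewrite lee_fin; have := g1 (t * X e); rewrite ler_norml => /andP[]; lra.
  rewrite RintegralD// Rintegral_cst// => /eqP.
  rewrite (_ : fine _ = fine 1%E) ?mulr1; last by congr fine; exact: probability_setT.
  by move=> /eqP/addIr.
apply: complexP.
  by rewrite [LHS](E cos (@cos_max R)) /= expR0 cos0; ring.
by rewrite [LHS](E sin (@sin_max R)) /= expR0 sin0; ring.
Qed.

Lemma is_charfun_drift b : is_charfun (fun t => expC (0 +i* (t * b))).
Proof.
apply: eq_is_charfun (is_charfun_two_point b _) => [t|]; last first.
  by apply/andP; split; [exact: ler01|exact: lexx].
by rewrite mul1r addrC subrK.
Qed.

Lemma is_charfun1 : is_charfun (fun=> 1).
Proof. by apply: eq_is_charfun (is_charfun_drift 0) => t; rewrite mulr0 -expC0. Qed.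

Lemma is_charfunX phi n : is_charfun phi -> is_charfun (fun t => phi t ^+ n).
Proof.
move=> cphi; elim: n => [|n IH]; first exact: is_charfun1.
by apply: eq_is_charfun (is_charfunM cphi IH) => t; rewrite exprS.
Qed.

(** Law of rare events: this is the limit of the N-th power of the
characteristic function of a two-point law of probability l/N at b. *)
Lemma is_charfun_poisson l b : 0 <= l ->
  is_charfun (fun t => expC (l%:C * (expC (0 +i* (t * b)) - 1))).
Proof.
move=> l0; pose m := Num.truncn l.
pose N n := (n + m).+1.
have N0 n : 0 < (N n)%:R :> R by [].
have lN n : l <= (N n)%:R.
  by apply: ltW; apply: lt_le_trans (truncnS_gt l) _; rewrite ler_nat ltnS leq_addl.
pose e t : R[i] := expC (0 +i* (t * b)).
pose z n t : R[i] := 1 + (l / (N n)%:R)%:C * (e t - 1).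
have /choice[F_ FE] n : is_charfun (fun t => z n t ^+ N n).
  apply: is_charfunX; apply: is_charfun_two_point.
  by rewrite divr_ge0//= ler_pdivrMr// mul1r.
have key t : modulus (charfun (F_ n) t - expC (l%:C * (e t - 1))) @[n --> \oo] --> (0 : R).
  have := expC_linear_error (l%:C * (e t - 1)) m.
  apply: (squeeze_cvgr _ (cvg_cst 0)); near=> n; rewrite modulus_ge0 andTb FE.
  pose a : R[i] := l%:C * (e t - 1).
  have NV : (N n)%:R * (N n)%:R^-1 = 1 :> R by rewrite mulfV// gt_eqF.
  (* Both N-th powers are compared through their bases, which lie in the unit
  disc since l/N is a probability and the real part of a is nonpositive. *)
  have zE : z n t = 1 + ((N n)%:R^-1)%:C * a.
    by rewrite /z /a mulrA -rmorphM/= (mulrC l).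
  have aE : expC a = expC (((N n)%:R^-1)%:C * a) ^+ N n.
    by rewrite -expCMn mulrn_real mulrA -rmorphM/= NV rmorph1 mul1r.
  have Re_e : complex.Re (e t) <= 1 by rewrite Re_expC/= expR0 mul1r cos_le1.
  rewrite -/a aE zE; apply: modulus_expX_sub.
  - rewrite -zE /z; set h := l / _.
    have h0 : 0 <= h by rewrite divr_ge0.
    have h1 : h <= 1 by rewrite ler_pdivrMr// mul1r.
    rewrite (_ : 1 + h%:C * (e t - 1) = (1 - h)%:C + h%:C * e t); last first.
      by rewrite rmorphB/= rmorph1; ring.
    apply: le_trans (modulusD _ _) _; rewrite modulusM !modulus_real modulus_expC/= expR0.
    by rewrite mulr1 !ger0_norm ?subr_ge0// subrK.
  - rewrite modulus_expC -expR0 ler_expR /a.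
    move: Re_e; case: (e t) => u v /= u1.
    rewrite !mul0r !subr0 mulr_ge0_le0 ?invr_ge0// mulr_ge0_le0//.
    by rewrite subr_le0.
have cvg_part (g : R[i] -> R) : (forall u v, g (u - v) = g u - g v) ->
    (forall u, `|g u| <= modulus u) -> forall t,
    g (charfun (F_ n) t) @[n --> \oo] --> g (expC (l%:C * (e t - 1))).
  move=> gB gle t; apply/cvgrPdist_lt => eps eps0; near=> n.
  rewrite distrC -gB; apply: le_lt_trans (gle _) _.
  by near: n; exact: (cvgr_lt _ (key t)).
apply: (@levy_continuity _ F_).
- by apply: (cvg_part (@complex.Re R)) => [[? ?] [? ?]//|u]; exact: Re_le_modulus.
- by apply: (cvg_part (@complex.Im R)) => [[? ?] [? ?]//|u]; exact: Im_le_modulus.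
- rewrite (_ : (fun t => _) = fun t => expR (l * (cos (b * t) - 1)) *
    cos (l * sin (b * t))); last first.
    apply/funext => t; rewrite Re_expC/= expR0 (mulrC t); congr (expR _ * cos _); ring.
  have c1 : continuous (fun t => l * (cos (b * t) - 1)).
    move=> t; apply: cvgM; first exact: cvg_cst.
    by apply: cvgB; [exact: continuous_cosM|exact: cvg_cst].
  have c2 : continuous (fun t => l * sin (b * t)).
    by move=> t; apply: cvgM; [exact: cvg_cst|exact: continuous_sinM].
  have h : expR (l * (cos (b * t) - 1)) * cos (l * sin (b * t)) @[t --> (0 : R)] -->
      expR (l * (cos (b * 0) - 1)) * cos (l * sin (b * 0)).
    apply: cvgM.
    - exact: (cvg_comp _ _ (c1 0) (@continuous_expR R _)).
    - exact: (cvg_comp _ _ (c2 0) (@continuous_cos R _)).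
  by rewrite mulr0 cos0 subrr mulr0 expR0 sin0 mulr0 cos0 mulr1 in h.
Unshelve. all: by end_near.
Qed.

Lemma is_charfun_compound_poisson n (g : R) (l b : nat -> R) :
  (forall j, 0 <= l j) ->
  is_charfun (fun t => expC (0 +i* (t * g) +
    \sum_(0 <= j < n) (l j)%:C * (expC (0 +i* (t * b j)) - 1))).
Proof.
move=> l0; elim: n => [|n IH].
  by apply: eq_is_charfun (is_charfun_drift g) => t; rewrite big_nil addr0.
apply: eq_is_charfun (is_charfunM IH (is_charfun_poisson (b n) (l0 n))) => t.
by rewrite -expCD big_nat_recr//= addrA.
Qed.

End CharacteristicFunctions.

(** * The kernel of the canonical representation *)

Section TrigBounds.
Context {R : realType}.
Implicit Types x y t : R.

(** The trigonometric bounds below follow from the mean value inequality, most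
of them from the one before by integration; the constants are not optimal. *)
Lemma derive_bound (f f' : R -> R) (y B : R) :
  (forall x, is_derive (x : R) (1 : R) f (f' x)) -> f 0 = 0 ->
  (forall c, `|c| <= `|y| -> `|f' c| <= B) -> `|f y| <= B * `|y|.
Proof.
move=> df f0 f'B; have cf := continuous_is_derive df.
have [y0|y0] := leP 0 y.
  have [|c c0y E] := MVT_segment y0 (fun x _ => df x); first exact: continuous_subspaceT.
  rewrite f0 !subr0 in E; rewrite E normrM ler_wpM2r// f'B//.
  by move: c0y; rewrite in_itv/= => /andP[c0 cy]; rewrite !ger0_norm.
have [|c cy0 E] := MVT_segment (ltW y0) (fun x _ => df x); first exact: continuous_subspaceT.
rewrite f0 !sub0r in E; rewrite -normrN E normrM normrN ler_wpM2r// f'B//.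
by move: cy0; rewrite in_itv/= => /andP[yc c0]; rewrite (ler0_norm c0) (ltr0_norm y0) lerN2.
Qed.

Lemma norm_sin_le y : `|sin y| <= `|y|.
Proof.
have := @derive_bound (@sin R) (@cos R) y 1 (@is_derive_sin R) (@sin0 R).
by rewrite mul1r; apply => c _; exact: cos_max.
Qed.

Lemma norm_cosB1_le y : `|cos y - 1| <= y ^+ 2.
Proof.
rewrite -real_normK ?num_real// expr2.
apply: (@derive_bound (fun y => cos y - 1) (fun y => - sin y)) => [x||c cy].
- by apply: is_derive_eq; rewrite oppr0 addr0.
- by rewrite cos0 subrr.
- by rewrite normrN (le_trans (norm_sin_le c)).
Qed.

Lemma norm_sinB_le y : `|sin y - y| <= `|y| ^+ 3.
Proof.
rewrite exprSr; apply: (@derive_bound (fun y => sin y - y) (fun y => cos y - 1)) => [|c cy].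
- by rewrite sin0 subrr.
- by rewrite (le_trans (norm_cosB1_le c))// -real_normK ?num_real// lerXn2r ?nnegrE.
Qed.

Lemma norm_sinB_le2 y : `|sin y - y| <= 2 * y ^+ 2.
Proof.
rewrite -(real_normK (num_real y)).
have [y1|y1] := leP `|y| 1.
  apply: le_trans (norm_sinB_le y) _; have := normr_ge0 y; nra.
have := ler_normB (sin y) y; have := sin_max y; nra.
Qed.

Lemma norm_cosB2_le y : `|cos y - 1 + y ^+ 2 / 2| <= `|y| ^+ 4.
Proof.
rewrite [leRHS]exprSr; apply: (@derive_bound (fun y => cos y - 1 + y ^+ 2 / 2)
  (fun y => - (sin y - y))) => [x||c cy].
- by apply: is_derive_eq; rewrite /GRing.scale/= subr0; field.
- by rewrite /= cos0 subrr expr0n/= mul0r addr0.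
- by rewrite normrN (le_trans (norm_sinB_le c))// lerXn2r ?nnegrE.
Qed.

End TrigBounds.

Section Kernel.
Context {R : realType}.
Implicit Types x y t : R.

Definition kernelRe t x : R :=
  if x == 0 then - (t ^+ 2 / 2) else (cos (t * x) - 1) * ((1 + x ^+ 2) / x ^+ 2).

Definition kernelIm t x : R :=
  if x == 0 then 0 else (sin (t * x) - t * sin x) * ((1 + x ^+ 2) / x ^+ 2).

Lemma Re_sin_integrand t x : complex.Re (sin_integrand t x) = kernelRe t x.
Proof.
rewrite /sin_integrand /kernelRe; case: eqP => //= _.
by rewrite expR0; ring.
Qed.

Lemma Im_sin_integrand t x : complex.Im (sin_integrand t x) = kernelIm t x.
Proof.
rewrite /sin_integrand /kernelIm; case: eqP => //= _.
by rewrite expR0; ring.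
Qed.

(** One bound for both parts of the kernel. It does not depend on x, which
dominates limits under the integral sign, and increases with the modulus of t,
which dominates them locally uniformly in t. *)
Definition kernel_bound t : R := 2 * t ^+ 2 + 3 * `|t| + 3.

Lemma le_kernel_bound s t : `|s| <= t -> kernel_bound s <= kernel_bound t.
Proof.
move=> st; have s0 := normr_ge0 s.
rewrite /kernel_bound -(real_normK (num_real s)) (ger0_norm (le_trans s0 st)); nra.
Qed.

Lemma kernelRe_le t x : `|kernelRe t x| <= kernel_bound t.
Proof.
rewrite /kernelRe /kernel_bound; have t0 := normr_ge0 t; have t2 := sqr_ge0 t.
case: eqP => [_|/eqP x0]; first by rewrite normrN ger0_norm; lra.
have x2 : 0 < x ^+ 2 by rewrite exprn_even_gt0.
rewrite (_ : _ * _ = (cos (t * x) - 1) / x ^+ 2 + (cos (t * x) - 1)); last by field.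
apply: le_trans (ler_normD _ _) _.
have h1 : `|(cos (t * x) - 1) / x ^+ 2| <= t ^+ 2.
  rewrite normrM normfV (ger0_norm (ltW x2)) ler_pdivrMr//.
  by rewrite -exprMn norm_cosB1_le.
have h2 : `|cos (t * x) - 1| <= 2.
  by rewrite (le_trans (ler_normB _ _))// normr1; have := cos_max (t * x); lra.
lra.
Qed.

Lemma kernelIm_le t x : `|kernelIm t x| <= kernel_bound t.
Proof.
rewrite /kernelIm /kernel_bound; have t0 := normr_ge0 t; have t2 := sqr_ge0 t.
case: eqP => [_|/eqP x0]; first by rewrite normr0; lra.
have x2 : 0 < x ^+ 2 by rewrite exprn_even_gt0.
(* Neither sin (t x) nor t sin x is O(x^2), but each is after subtraction
of t x. *)
rewrite (_ : _ * _ = (sin (t * x) - t * x) / x ^+ 2 - t * (sin x - x) / x ^+ 2 +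
  (sin (t * x) - t * sin x)); last by field.
have h1 : `|(sin (t * x) - t * x) / x ^+ 2| <= 2 * t ^+ 2.
  rewrite normrM normfV (ger0_norm (ltW x2)) ler_pdivrMr//.
  by rewrite -mulrA -exprMn norm_sinB_le2.
have h2 : `|t * (sin x - x) / x ^+ 2| <= 2 * `|t|.
  rewrite normrM normfV (ger0_norm (ltW x2)) ler_pdivrMr// normrM.
  by rewrite (mulrC 2) -mulrA ler_wpM2l// norm_sinB_le2.
have h3 : `|sin (t * x) - t * sin x| <= 1 + `|t|.
  rewrite (le_trans (ler_normB _ _))// lerD ?sin_max// normrM ler_piMr//.
  exact: sin_max.
apply: le_trans (ler_normD _ _) _.
have := ler_normB ((sin (t * x) - t * x) / x ^+ 2) (t * (sin x - x) / x ^+ 2).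
lra.
Qed.

Lemma continuous_weight x : x != 0 -> {for x, continuous (fun x : R => (1 + x ^+ 2) / x ^+ 2)}.
Proof.
move=> x0; apply: cvgM.
  by apply: cvgD; [exact: cvg_cst|exact: exprn_continuous].
by apply: cvgV; [rewrite expf_neq0|exact: exprn_continuous].
Qed.

Lemma continuous_at0_bound (f : R -> R) (C : R) :
  (forall y, `|f 0 - f y| <= C * (`|y| + y ^+ 2)) -> f y @[y --> (0 : R)] --> f 0.
Proof.
move=> fC.
have h : C * (`|y| + y ^+ 2) @[y --> (0 : R)] --> (0 : R).
  have c : continuous (fun y : R => C * (`|y| + y ^+ 2)).
    move=> y; apply: cvgM; first exact: cvg_cst.
    by apply: cvgD; [exact: norm_continuous|exact: exprn_continuous].
  by have := c 0; rewrite /continuous_at normr0 expr0n addr0 mulr0.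
apply/cvgrPdist_le => e e0; near=> y; apply: le_trans (fC y) _.
by near: y; exact: (cvgr_le _ h).
Unshelve. all: by end_near.
Qed.

(** The Taylor expansion of the cosine to order 4 shows that the value
- t^2/2 removes the singularity at 0. *)
Lemma continuous_kernelRe t : continuous (kernelRe t).
Proof.
move=> x; have [->|x0] := eqVneq x 0.
  apply: (@continuous_at0_bound _ (t ^+ 4 + t ^+ 2)) => y.
  have y0 := normr_ge0 y; have t2 := sqr_ge0 t; have y2 := sqr_ge0 y.
  have t4 : 0 <= t ^+ 4 by rewrite exprn_even_ge0.
  rewrite /kernelRe eqxx; case: eqP => [_|/eqP yn0].
    by rewrite subrr normr0 mulr_ge0// addr_ge0.
  have y2' : 0 < y ^+ 2 by rewrite exprn_even_gt0.
  rewrite (_ : _ - _ = - ((cos (t * y) - 1 + (t * y) ^+ 2 / 2) / y ^+ 2 +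
    (cos (t * y) - 1))); last by field.
  rewrite normrN; apply: le_trans (ler_normD _ _) _.
  have h1 : `|(cos (t * y) - 1 + (t * y) ^+ 2 / 2) / y ^+ 2| <= t ^+ 4 * y ^+ 2.
    rewrite normrM normfV (ger0_norm (ltW y2')) ler_pdivrMr//.
    rewrite (_ : t ^+ 4 * _ * _ = (t * y) ^+ 4); last by ring.
    by apply: le_trans (norm_cosB2_le _) _; rewrite -normrX ger0_norm// exprn_even_ge0.
  have h2 := norm_cosB1_le (t * y); rewrite exprMn in h2; nra.
have e : {near x, (fun y => (cos (t * y) - 1) * ((1 + y ^+ 2) / y ^+ 2)) =1 kernelRe t}.
  near=> y; rewrite /kernelRe ifF//; apply/negbTE.
  by near: y; exact: (cvgr_neq0 _ cvg_id x0).
rewrite /continuous_at -(nbhs_singleton e).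
apply: cvg_trans (near_eq_cvg e) _.
apply: cvgM; last exact: continuous_weight.
by apply: cvgB; [exact: continuous_cosM|exact: cvg_cst].
Unshelve. all: by end_near.
Qed.

(** At 0 both sin (t x) - t x and sin x - x are O(x^3), so the division by
x^2 leaves a quantity that tends to 0. *)
Lemma continuous_kernelIm t : continuous (kernelIm t).
Proof.
move=> x; have [->|x0] := eqVneq x 0.
  apply: (@continuous_at0_bound _ (`|t| ^+ 3 + 3 * `|t|)) => y.
  have y0 := normr_ge0 y; have t0 := normr_ge0 t; have y2 := sqr_ge0 y.
  have t3 : 0 <= `|t| ^+ 3 by rewrite exprn_ge0.
  rewrite /kernelIm eqxx; case: eqP => [_|/eqP yn0].
    by rewrite subrr normr0 mulr_ge0// addr_ge0// mulr_ge0.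
  have y2' : 0 < y ^+ 2 by rewrite exprn_even_gt0.
  rewrite (_ : _ - _ = - ((sin (t * y) - t * y) / y ^+ 2 - t * (sin y - y) / y ^+ 2 +
    (sin (t * y) - t * sin y))); last by field.
  rewrite normrN; apply: le_trans (ler_normD _ _) _.
  have yE : `|y| ^+ 3 = `|y| * y ^+ 2 by rewrite exprS real_normK ?num_real.
  have h1 : `|(sin (t * y) - t * y) / y ^+ 2| <= `|t| ^+ 3 * `|y|.
    rewrite normrM normfV (ger0_norm (ltW y2')) ler_pdivrMr// -mulrA -yE -exprMn -normrM.
    exact: norm_sinB_le.
  have h2 : `|t * (sin y - y) / y ^+ 2| <= `|t| * `|y|.
    rewrite normrM normfV (ger0_norm (ltW y2')) ler_pdivrMr// normrM -mulrA -yE ler_wpM2l//.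
    exact: norm_sinB_le.
  have h3 : `|sin (t * y) - t * sin y| <= 2 * (`|t| * `|y|).
    apply: le_trans (ler_normB _ _) _; rewrite mulr_natl mulr2n lerD//.
      by rewrite -normrM norm_sin_le.
    by rewrite normrM ler_wpM2l// norm_sin_le.
  have h4 := ler_normB ((sin (t * y) - t * y) / y ^+ 2) (t * (sin y - y) / y ^+ 2).
  have h5 : 0 <= `|t| ^+ 3 * y ^+ 2 by rewrite mulr_ge0.
  have h6 : 0 <= `|t| * y ^+ 2 by rewrite mulr_ge0.
  lra.
have e : {near x, (fun y => (sin (t * y) - t * sin y) * ((1 + y ^+ 2) / y ^+ 2)) =1 kernelIm t}.
  near=> y; rewrite /kernelIm ifF//; apply/negbTE.
  by near: y; exact: (cvgr_neq0 _ cvg_id x0).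
rewrite /continuous_at -(nbhs_singleton e).
apply: cvg_trans (near_eq_cvg e) _.
apply: cvgM; last exact: continuous_weight.
apply: cvgB; first exact: continuous_sinM.
by apply: cvgM; [exact: cvg_cst|exact: continuous_sin].
Unshelve. all: by end_near.
Qed.

Lemma continuous_kernelRe_t x : continuous (kernelRe ^~ x).
Proof.
rewrite /kernelRe; case: eqP => [_|_] t.
  apply: cvgN; apply: cvgM; last exact: cvg_cst.
  exact: exprn_continuous.
apply: cvgM; last exact: cvg_cst.
apply: cvgB; last exact: cvg_cst.
by apply: continuous_comp; [exact: mulrr_continuous|exact: continuous_cos].
Qed.

Lemma continuous_kernelIm_t x : continuous (kernelIm ^~ x).
Proof.
rewrite /kernelIm; case: eqP => [_|_] t; first exact: cvg_cst.
apply: cvgM; last exact: cvg_cst.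
apply: cvgB; last exact: mulrr_continuous.
by apply: continuous_comp; [exact: mulrr_continuous|exact: continuous_sin].
Qed.

End Kernel.

Section KernelIntegral.
Context {R : realType}.
Context (K : {measure set (measurableTypeR R) -> \bar R}).
Hypothesis K_fin : (K setT < +oo)%E.
Implicit Types t x : R.

Lemma integralC_sin_integrand t : integralC K (sin_integrand t) =
  (\int[K]_x kernelRe t x) +i* (\int[K]_x kernelIm t x).
Proof.
rewrite /integralC; congr (_ +i* _).
  by apply: eq_Rintegral => x _; rewrite Re_sin_integrand.
by apply: eq_Rintegral => x _; rewrite Im_sin_integrand.
Qed.

Lemma measurable_kernelRe t : measurable_fun setT (kernelRe t : measurableTypeR R -> R).
Proof. exact: continuous_measurable_fun (@continuous_kernelRe R t). Qed.

Lemma measurable_kernelIm t : measurable_fun setT (kernelIm t : measurableTypeR R -> R).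
Proof. exact: continuous_measurable_fun (@continuous_kernelIm R t). Qed.

Lemma integrable_kernelRe t : K.-integrable setT (EFin \o kernelRe t).
Proof. exact: (bounded_integrable K_fin (measurable_kernelRe t) (kernelRe_le t)). Qed.

Lemma integrable_kernelIm t : K.-integrable setT (EFin \o kernelIm t).
Proof. exact: (bounded_integrable K_fin (measurable_kernelIm t) (kernelIm_le t)). Qed.

(** Local domination: on ]t - 1, t + 1[ the bound at |t| + 1 applies. *)
Lemma continuous_bounded_family (f : R -> R -> R) :
  (forall t, K.-integrable setT (EFin \o f t)) ->
  (forall x, continuous (f ^~ x)) ->
  (forall t x, `|f t x| <= kernel_bound t) ->
  continuous (fun t => \int[K]_x f t x).
Proof.
move=> fi fc fB t.
have It : t \in `]t - 1, t + 1[%classic by rewrite inE/= in_itv/= ltrBlDr ltrDl ltr01.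
have ig : K.-integrable setT (EFin \o cst (kernel_bound (`|t| + 1))).
  apply: (bounded_integrable K_fin (M := `|kernel_bound (`|t| + 1)|)) => [|x].
    exact: measurable_cst.
  exact: lexx.
apply: (@continuity_under_integral _ _ _ K f setT measurableT (t - 1) (t + 1) _ _ _ ig) => //.
- by apply: aeW => x _ s _; exact: fc.
- move=> s; rewrite /= in_itv/= => /andP[s1 s2]; apply: aeW => x _.
  apply: le_trans (fB s x) _; apply: le_kernel_bound.
  have := lerB_dist s t; have : `|s - t| <= 1 by rewrite ler_norml; apply/andP; split; lra.
  lra.
Qed.

Lemma continuous_int_kernelRe : continuous (fun t => \int[K]_x kernelRe t x).
Proof.
apply: continuous_bounded_family => [t|x|t x].
- exact: integrable_kernelRe.
- exact: continuous_kernelRe_t.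
- exact: kernelRe_le.
Qed.

Lemma continuous_int_kernelIm : continuous (fun t => \int[K]_x kernelIm t x).
Proof.
apply: continuous_bounded_family => [t|x|t x].
- exact: integrable_kernelIm.
- exact: continuous_kernelIm_t.
- exact: kernelIm_le.
Qed.

End KernelIntegral.

(** * Existence of laws with a canonical representation *)

Section Discretisation.
Context {R : realType}.
Implicit Types (f : R -> R) (x : R).

(** The first 2 (m+1)^2 of these half-open intervals of length 1/(m+1)
partition [-(m+1), m+1[. *)
Definition cell (m j : nat) : set R := [set x | j%:R <= (x + m.+1%:R) * m.+1%:R < j.+1%:R].

(** The midpoint of the cell. Midpoints avoid 0, where the weight
(1 + x^2)/x^2 of the kernel is infinite. *)
Definition node (m j : nat) : R := (j%:R + 2^-1) / m.+1%:R - m.+1%:R.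

Definition cell_count (m : nat) : nat := (2 * (m.+1 * m.+1))%N.

Definition cell_sum f m x := \sum_(0 <= j < cell_count m) f (node m j) * \1_(cell m j) x.

Lemma measurable_cell m j : measurable (cell m j : set (measurableTypeR R)).
Proof.
have -> : cell m j = (fun x : R => (x + m.+1%:R) * m.+1%:R) @^-1` `[j%:R, j.+1%:R[.
  by apply/seteqP; split => x; rewrite /cell/= in_itv.
rewrite -[X in measurable X]setTI.
have mf : measurable_fun setT (fun x : measurableTypeR R => (x + m.+1%:R) * m.+1%:R).
  by apply: measurable_funM => //; apply: measurable_funD => //; exact: measurable_id.
by apply: mf => //; exact: measurable_itv.
Qed.

(** A vanishing node would make the odd number 2 j + 1 equal to 2 (m+1)^2. *)
Lemma node_neq0 m j : node m j != 0.
Proof.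
rewrite /node subr_eq0; apply/eqP => h.
have M0 : m.+1%:R != 0 :> R by rewrite pnatr_eq0.
have : (2 * j + 1)%:R = (2 * (m.+1 * m.+1))%:R :> R.
  rewrite natrD !natrM.
  have : (j%:R + 2^-1) = m.+1%:R * m.+1%:R :> R by rewrite -[LHS](divfK M0) h.
  by move=> <-; field.
by move=> /eqP; rewrite eqr_nat => /eqP/(congr1 odd); rewrite oddD !oddM.
Qed.

(** The only cell that can contain x is the one whose index is the integer
part of (x + m + 1) (m + 1). *)
Lemma cell_sumE f m x : cell_sum f m x =
  let y := (x + m.+1%:R) * m.+1%:R in
  if (0 <= y) && (Num.truncn y < cell_count m)%N then f (node m (Num.truncn y)) else 0.
Proof.
rewrite /cell_sum /=; set y := (x + _) * _.
have E j : \1_(cell m j) x = ((0 <= y) && (Num.truncn y == j))%:R :> R.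
  rewrite indicE; congr (nat_of_bool _)%:R; apply/idP/idP.
    move=> /set_mem; rewrite /cell/= -/y => jy.
    by move/andP : (jy) => [j1 _]; rewrite (le_trans _ j1)//=; apply/eqP/truncn_def.
  move=> /andP[y0 /eqP <-]; apply/mem_set; rewrite /cell/= -/y.
  exact: truncn_itv.
under eq_bigr do rewrite E.
have [y0|y0] := leP 0 y; last by rewrite /= big1// => j _; rewrite mulr0.
rewrite /=; case: ltnP => h.
  rewrite big_mkord (bigD1 (Ordinal h))//= eqxx mulr1 big1 ?addr0// => j jh.
  rewrite (_ : _ == _ = false) ?mulr0//; apply: contraNF jh => /eqP e.
  by apply/eqP/val_inj.
rewrite big_nat big1// => j /andP[_ jN].
by rewrite (_ : _ == _ = false) ?mulr0//; apply/negbTE; rewrite neq_ltn (leq_trans jN h) orbT.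
Qed.

Lemma cell_sum_bound f m x B : (forall x, `|f x| <= B) -> `|cell_sum f m x| <= B.
Proof.
move=> fB; rewrite cell_sumE /=; case: ifP => _; first exact: fB.
by rewrite normr0 (le_trans _ (fB 0)).
Qed.

Lemma node_dist m x : let y := (x + m.+1%:R) * m.+1%:R in 0 <= y ->
  `|node m (Num.truncn y) - x| <= m.+1%:R^-1.
Proof.
move=> y y0; have /andP[h1 h2] := truncn_itv y0.
have M0 : 0 < m.+1%:R :> R by [].
have -> : node m (Num.truncn y) - x = ((Num.truncn y)%:R + 2^-1 - y) / m.+1%:R.
  rewrite /node /y; field; exact: lt0r_neq0.
rewrite normrM normfV (gtr0_norm M0) ler_piMl ?invr_ge0//.
rewrite -natr1 in h2; rewrite ler_norml; apply/andP; split; lra.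
Qed.

Lemma cell_sum_cvg f x : continuous f -> cell_sum f m x @[m --> \oo] --> f x.
Proof.
move=> cf; apply/cvgrPdist_lt => e e0.
have /cvgrPdist_lt/(_ _ e0)/nbhs_ballP[d /= d0 fd] := cf x.
near=> m.
have mx : `|x| < m.+1%:R.
  by rewrite (@le_lt_trans _ _ m%:R) ?ltr_nat//; near: m; exact: nbhs_infty_ger.
have M0 : 0 < m.+1%:R :> R by [].
have y0 : 0 <= (x + m.+1%:R) * m.+1%:R.
  rewrite mulr_ge0 ?ler0n// -[x]opprK addrC subr_ge0 lerNl.
  by move: mx; rewrite ltr_norml => /andP[/ltW].
rewrite cell_sumE /= y0 /= ifT.
  apply: fd; rewrite /ball/= distrC; apply: le_lt_trans (node_dist y0) _.
  by near: m; exact: (near_infty_natSinv_lt (PosNum d0)).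
have /andP[h1 _] := truncn_itv y0.
rewrite -(ltr_nat R); apply: le_lt_trans h1 _.
rewrite /cell_count !natrM mulrA ltr_pM2r//.
move: mx; rewrite ltr_norml => /andP[_]; lra.
Unshelve. all: by end_near.
Qed.

Context (K : {measure set (measurableTypeR R) -> \bar R}).
Hypothesis K_fin : (K setT < +oo)%E.

Lemma integrable_cell m j : K.-integrable setT (EFin \o (\1_(cell m j) : R -> R)).
Proof.
apply: (bounded_integrable K_fin (M := 1)) => [|x].
  exact: measurable_indic (measurable_cell m j).
by rewrite indicE normr_nat lern1 leq_b1.
Qed.

Lemma integrable_cell_term f m j :
  K.-integrable setT (EFin \o (fun x => f (node m j) * \1_(cell m j) x)).
Proof. exact: integrable_ZlR (integrable_cell m j). Qed.

Lemma integrable_cell_sum f m n :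
  K.-integrable setT (EFin \o (fun x => \sum_(0 <= j < n) f (node m j) * \1_(cell m j) x)).
Proof.
elim: n => [|n IH].
  under eq_fun do rewrite big_nil; apply: (bounded_integrable K_fin (M := 0)) => [|x].
    exact: measurable_cst.
  by rewrite normr0.
under eq_fun do rewrite big_nat_recr//=.
exact: integrable_addR IH (integrable_cell_term f m n).
Qed.

Lemma Rintegral_cell_sum f m : \int[K]_x cell_sum f m x =
  \sum_(0 <= j < cell_count m) f (node m j) * fine (K (cell m j)).
Proof.
rewrite /cell_sum; elim: (cell_count m) => [|n IH].
  by under eq_Rintegral do rewrite big_nil; rewrite Rintegral_cst// mul0r big_nil.
under eq_Rintegral do rewrite big_nat_recr//=.
rewrite (RintegralD measurableT (integrable_cell_sum f m n) (integrable_cell_term f m n)).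
rewrite IH big_nat_recr//=; congr (_ + _).
rewrite (RintegralZl _ measurableT (integrable_cell m n)); congr (_ * _).
by rewrite /Rintegral integral_indic ?setIT//; exact: measurable_cell.
Qed.

Lemma cvg_Rintegral_cell_sum f B : continuous f -> (forall x, `|f x| <= B) ->
  \int[K]_x cell_sum f m x @[m --> \oo] --> \int[K]_x f x.
Proof.
move=> cf fB; apply: (bounded_dominated_cvg K_fin (M := B)).
- by move=> m; apply/measurable_EFinP; exact: measurable_int (integrable_cell_sum f m _).
- by move=> m x; exact: cell_sum_bound.
- by move=> x; exact: cell_sum_cvg.
Qed.

End Discretisation.

Section LevyKhintchine.
Context {R : realType}.
Context (K : {measure set (measurableTypeR R) -> \bar R}).
Hypothesis K_fin : (K setT < +oo)%E.

Let weight (x : R) : R := (1 + x ^+ 2) / x ^+ 2.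

(** The kernel integral of a step function is a finite sum, so the exponent
is that of a compound Poisson law whose jumps are the nodes; the compensators
t sin x are linear in t and go into the drift b. The factor c is kept apart
because n-th roots will use c = 1/n. *)
Lemma is_charfun_cell_sum (g c : R) m : 0 <= c -> is_charfun (fun t => expC
  ((c * \int[K]_x cell_sum (kernelRe t) m x) +i*
   (t * g + c * \int[K]_x cell_sum (kernelIm t) m x))).
Proof.
move=> c0.
pose a j : R := c * fine (K (cell m j)) * weight (node m j).
pose b : R := g - \sum_(0 <= j < cell_count m) a j * sin (node m j).
have a0 j : 0 <= a j.
  by rewrite !mulr_ge0 ?fine_ge0 ?invr_ge0 ?addr_ge0 ?sqr_ge0.
apply: eq_is_charfun (is_charfun_compound_poisson (cell_count m) b (node m) a0) => t.
congr expC; rewrite !(Rintegral_cell_sum K_fin); apply: complexP.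
- rewrite Re_add Re_sum /= add0r mulr_sumr; apply: eq_bigr => j _.
  rewrite /kernelRe (negbTE (node_neq0 m j)) expR0 /a /weight; ring.
- rewrite Im_add Im_sum /= mulr_sumr /b mulrBr -addrA; congr (_ + _).
  rewrite mulr_sumr addrC; apply/eqP; rewrite subr_eq -big_split/=; apply/eqP.
  apply: eq_bigr => j _.
  rewrite /kernelIm (negbTE (node_neq0 m j)) expR0 /a /weight; ring.
Qed.

(** Discretisation of K gives compound Poisson exponents converging pointwise
to the given one, and the continuity theorem applies since the limit is
continuous at 0. *)
Theorem levy_khintchine_charfun (g c : R) : 0 <= c ->
  is_charfun (fun t => expC (0 +i* (t * g) + c%:C * integralC K (sin_integrand t))).
Proof.
move=> c0.
have E t : 0 +i* (t * g) + c%:C * integralC K (sin_integrand t) =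
    (c * \int[K]_x kernelRe t x) +i* (t * g + c * \int[K]_x kernelIm t x).
  by rewrite integralC_sin_integrand; apply: complexP => /=; ring.
apply: (@eq_is_charfun _ (fun t => expC
    ((c * \int[K]_x kernelRe t x) +i* (t * g + c * \int[K]_x kernelIm t x)))) => [t|].
  by rewrite E.
have /choice[F_ FE] := fun m => is_charfun_cell_sum g m c0.
have cR t : c * \int[K]_x cell_sum (kernelRe t) m x @[m --> \oo] -->
    c * \int[K]_x kernelRe t x.
  apply: cvgM; first exact: cvg_cst.
  exact: cvg_Rintegral_cell_sum (@continuous_kernelRe R t) (kernelRe_le t).
have cI t : t * g + c * \int[K]_x cell_sum (kernelIm t) m x @[m --> \oo] -->
    t * g + c * \int[K]_x kernelIm t x.
  apply: cvgD; first exact: cvg_cst.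
  apply: cvgM; first exact: cvg_cst.
  exact: cvg_Rintegral_cell_sum (@continuous_kernelIm R t) (kernelIm_le t).
apply: (@levy_continuity _ F_) => [t|t|].
- rewrite (_ : (fun m => _) = fun m => expR (c * \int[K]_x cell_sum (kernelRe t) m x) *
    cos (t * g + c * \int[K]_x cell_sum (kernelIm t) m x)); last first.
    by apply/funext => m; rewrite FE Re_expC.
  rewrite Re_expC; apply: cvgM.
  + exact: (cvg_comp _ _ (@cR t) (@continuous_expR R _)).
  + exact: (cvg_comp _ _ (@cI t) (@continuous_cos R _)).
- rewrite (_ : (fun m => _) = fun m => expR (c * \int[K]_x cell_sum (kernelRe t) m x) *
    sin (t * g + c * \int[K]_x cell_sum (kernelIm t) m x)); last first.
    by apply/funext => m; rewrite FE Im_expC.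
  rewrite Im_expC; apply: cvgM.
  + exact: (cvg_comp _ _ (@cR t) (@continuous_expR R _)).
  + exact: (cvg_comp _ _ (@cI t) (@continuous_sin R _)).
- have c1 : continuous (fun t => c * \int[K]_x kernelRe t x).
    by move=> t; apply: cvgM; [exact: cvg_cst|exact: continuous_int_kernelRe].
  have c2 : continuous (fun t : R => t * g + c * \int[K]_x kernelIm t x).
    move=> t; apply: cvgD; first exact: mulrr_continuous.
    by apply: cvgM; [exact: cvg_cst|exact: continuous_int_kernelIm].
  have h : expR (c * \int[K]_x kernelRe t x) * cos (t * g + c * \int[K]_x kernelIm t x)
      @[t --> (0 : R)] -->
      expR (c * \int[K]_x kernelRe 0 x) * cos (0 * g + c * \int[K]_x kernelIm 0 x).
    apply: cvgM.
    + exact: (cvg_comp _ _ (c1 0) (@continuous_expR R _)).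
    + exact: (cvg_comp _ _ (c2 0) (@continuous_cos R _)).
  rewrite (_ : (fun t => _) = fun t => expR (c * \int[K]_x kernelRe t x) *
      cos (t * g + c * \int[K]_x kernelIm t x)); last first.
    by apply/funext => t; rewrite Re_expC.
  have R0 : \int[K]_x kernelRe 0 x = 0.
    under eq_Rintegral do rewrite /kernelRe expr0n/= mul0r oppr0 mul0r cos0 subrr mul0r if_same.
    by rewrite Rintegral_cst// mul0r.
  have I0 : \int[K]_x kernelIm 0 x = 0.
    under eq_Rintegral do rewrite /kernelIm !mul0r sin0 subrr mul0r if_same.
    by rewrite Rintegral_cst// mul0r.
  by rewrite R0 I0 !mulr0 mul0r addr0 expR0 cos0 mulr1 in h.
Qed.

End LevyKhintchine.

(** * Infinite divisibility and the rational class *)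

Section InfiniteDivisibility.
Context {R : realType}.
Implicit Types F : distribution_function R.

Lemma convolution_pow_distribution F n : exists P : distribution_function R,
  (forall x, P x = convolution_powS F n x) /\
  (forall t, charfun P t = charfun F t ^+ n.+1).
Proof.
elim: n => [|n [P [PE cP]]]; first by exists F.
have [Q [QE cQ]] := convolution_distribution P F.
exists Q; split=> [x|t]; last by rewrite cQ cP -exprSr.
by rewrite QE /convolution_powS iterS -/(convolution_powS F n) (funext PE).
Qed.

Context (K : {measure set (measurableTypeR R) -> \bar R}).
Hypothesis K_fin : (K setT < +oo)%E.

(** The n-th root is the law with g/n and K/n. Its n-fold convolution has the
same characteristic function as F, hence equals F. *)
Lemma levy_khintchine_infinitely_divisible F (g : R) :
  (forall t, charfun F t = expC (0 +i* (t * g) + integralC K (sin_integrand t))) ->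
  infinitely_divisible F.
Proof.
move=> FE n.
have n0 : 0 <= n.+1%:R^-1 :> R by rewrite invr_ge0.
have [Fn FnE] := levy_khintchine_charfun K_fin (g / n.+1%:R) n0.
exists Fn => x; have [P [<- cP]] := convolution_pow_distribution Fn n.
apply: charfun_inj => t; rewrite FE cP FnE -expCMn; congr expC.
have N0 : n.+1%:R != 0 :> R by rewrite pnatr_eq0.
rewrite mulrn_real mulrDr; congr (_ + _); last first.
  by rewrite mulrA -rmorphM/= mulfV// rmorph1 mul1r.
by apply: complexP => /=; [ring|field].
Qed.

End InfiniteDivisibility.

Section JordanMeasures.
Context {R : realType}.

Lemma lebesgue_stieltjes_lty (f : cumulative R R) (M : R) :
  (forall a b, a <= b -> f b - f a <= M) ->
  (lebesgue_stieltjes_measure f setT < +oo)%E.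
Proof.
move=> fM; rewrite -(bigcup_itvT false false).
pose I n : set (measurableTypeR R) := `]- (n%:R), n%:R]%classic.
have cI : (lebesgue_stieltjes_measure f (I n)) @[n --> \oo] -->
    lebesgue_stieltjes_measure f (\bigcup_n I n).
  apply: nondecreasing_cvg_mu; rewrite /I//; first exact: bigcup_measurable.
  by move=> *; apply/subsetPset/subset_itv; rewrite leBSide/= ?lerN2 ler_nat.
apply: (@le_lt_trans _ _ M%:E); last exact: ltry.
apply: (cvge_to_le cI); apply: nearW => n.
rewrite /lebesgue_stieltjes_measure /measure_extension/= measurable_mu_extE/=; last exact: is_ocitv.
have n0 : - n%:R <= n%:R :> R by rewrite ge0_cp.
by rewrite wlength_itv_bnd// lee_fin fM.
Qed.

Context (G : classV R).

Let tv_le a b : a <= b -> `|G b - G a| <= fine (total_variation a b G).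
Proof.
move=> ab; rewrite -lee_fin fineK ?(finite_BV_fin (V_finite_BV G))//.
exact: total_variation_ge.
Qed.

Lemma negative_variation_measure_lty :
  (lebesgue_stieltjes_measure (negative_variation G) setT < +oo)%E.
Proof.
have [M HM] := V_finite_BV G.
apply: (@lebesgue_stieltjes_lty _ M) => a b ab.
rewrite -[leLHS]/(negative_variation G b - negative_variation G a).
rewrite /negative_variation (variationNyD (V_finite_BV G) ab).
have := tv_le ab; have : fine (total_variation a b G) <= M.
  by rewrite -lee_fin fineK ?(finite_BV_fin (V_finite_BV G))// HM.
rewrite ler_norml => ? /andP[? ?]; lra.
Qed.

Lemma positive_variation_measure_lty :
  (lebesgue_stieltjes_measure (positive_variation G) setT < +oo)%E.
Proof.
have [M HM] := V_finite_BV G.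
apply: (@lebesgue_stieltjes_lty _ M) => a b ab.
rewrite -[leLHS]/(positive_variation G b - positive_variation G a).
rewrite /positive_variation (variationNyD (V_finite_BV G) ab).
have := tv_le ab; have : fine (total_variation a b G) <= M.
  by rewrite -lee_fin fineK ?(finite_BV_fin (V_finite_BV G))// HM.
rewrite ler_norml => ? /andP[? ?]; lra.
Qed.

(** F1 has drift g and the measure of the positive variation, F2 has the
measure of the negative variation. The characteristic function of F1 is then
the product of those of F and F2. *)
Lemma levy_khintchine_classQ (F : distribution_function R) (g : R) :
  (forall t, charfun F t = expC (0 +i* (t * g) + LS_integral G (sin_integrand t))) ->
  classQ F.
Proof.
move=> FE.
have [F1 F1E] := levy_khintchine_charfun positive_variation_measure_lty g ler01.
have [F2 F2E] := levy_khintchine_charfun negative_variation_measure_lty 0 ler01.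
have {}F1E t : charfun F1 t = expC (0 +i* (t * g) +
    integralC (lebesgue_stieltjes_measure (positive_variation G)) (sin_integrand t)).
  by rewrite F1E mul1r.
have {}F2E t : charfun F2 t = expC (0 +i* (t * 0) +
    integralC (lebesgue_stieltjes_measure (negative_variation G)) (sin_integrand t)).
  by rewrite F2E mul1r.
exists F1, F2; split.
- exact: (levy_khintchine_infinitely_divisible positive_variation_measure_lty F1E).
- exact: (levy_khintchine_infinitely_divisible negative_variation_measure_lty F2E).
- have [F3 [F3E cF3]] := convolution_distribution F F2.
  move=> x; rewrite -F3E; apply: charfun_inj => t.
  (* The exponent of F2 is cancelled by the negative part of dG. *)
  rewrite F1E cF3 FE F2E -expCD (mulr0 t); congr expC.
  have -> : 0 +i* 0 = 0 :> R[i] by [].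
  by rewrite add0r /LS_integral -addrA subrK.
Qed.

End JordanMeasures.

(** * Continuous arguments *)

Section ContinuousArgument.
Context {R : realType}.
Implicit Types (A B : R -> R) (s t : R).

Lemma cos_eq1_small (v : R) : `|v| <= 1 -> cos v = 1 -> v = 0.
Proof.
move=> v1 cv; apply/eqP; rewrite -normr_eq0; apply/eqP.
apply: (@cos_inj R); rewrite ?in_itv/= ?lexx ?pi_ge0//.
  by rewrite normr_ge0/= (le_trans v1)// (le_trans _ (pi_ge2 R))// ler1n.
by rewrite cos_norm cos0.
Qed.

(** The difference D of two arguments has cosine 1 everywhere, so it takes no
small nonzero value; by the intermediate value theorem it stays at D 0 = 0. *)
Lemma argument_unique A B (T : R) : continuous A -> continuous B -> A 0 = B 0 ->
  (forall s, `|s| <= T -> cos (A s) = cos (B s) /\ sin (A s) = sin (B s)) ->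
  forall s, `|s| <= T -> A s = B s.
Proof.
move=> cA cB AB0 AB s sT; apply/eqP; rewrite -subr_eq0; apply/eqP.
pose D x := A x - B x; rewrite -/(D s).
have cD : continuous D by move=> x; apply: cvgB; [exact: cA|exact: cB].
have D0 : D 0 = 0 by rewrite /D AB0 subrr.
(* A value between 0 and D s, of modulus at most 1, that vanishes only with
D s. *)
pose v := D s / (1 + `|D s|).
have d0 : 0 < 1 + `|D s| by rewrite ltr_pwDl.
have v1 : `|v| <= 1.
  by rewrite normrM normfV (gtr0_norm d0) ler_pdivrMr// mul1r lerDr.
have vs : Num.min 0 (D s) <= v <= Num.max 0 (D s).
  rewrite /v; have [h|h] := leP 0 (D s).
    by rewrite divr_ge0 ?(ltW d0)//= ler_pdivrMr// ler_peMr// lerDl.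
  rewrite ler_pdivlMr// ler_neMr ?lerDl// ?(ltW h)//=.
  by rewrite pmulr_lle0 ?invr_gt0// ltW.
have [c cs Dc] : exists2 c, `|c| <= `|s| & D c = v.
  have [s0|s0] := leP 0 s.
    have [||c c0s Dc] := @IVT R D 0 s v s0; last by exists c => //;
      move: c0s; rewrite in_itv/= => /andP[h1 h2]; rewrite !ger0_norm.
    - exact: continuous_subspaceT.
    - by rewrite D0.
  have [||c c0s Dc] := @IVT R D s 0 v (ltW s0); last by exists c => //;
    move: c0s; rewrite in_itv/= => /andP[h1 h2]; rewrite (ler0_norm h2) (ltr0_norm s0) lerN2.
  - exact: continuous_subspaceT.
  - by rewrite D0 minC maxC.
have cv : cos v = 1.
  have [cc sc] := AB c (le_trans cs sT).
  by rewrite -Dc cosB cc sc -!expr2 cos2Dsin2.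
have := cos_eq1_small v1 cv; rewrite /v => /eqP.
by rewrite mulf_eq0 invr_eq0 (gt_eqF d0) orbF => /eqP.
Qed.

Context (u v : R -> R).
Hypothesis cu : continuous u.
Hypothesis cv : continuous v.
Hypothesis uv1 : forall t, u t ^+ 2 + v t ^+ 2 = 1.
Hypothesis u0 : u 0 = 1.
Hypothesis v0 : v 0 = 0.

(** Uniform continuity on [-N, N] of the curve (u, v): for close parameters the
inner product of two of its points is positive. *)
Lemma short_arcs (N : R) : exists n : nat, forall s t, `|s| <= N -> `|t| <= N ->
  `|s - t| <= n.+1%:R^-1 -> 0 < u s * u t + v s * v t.
Proof.
apply: contrapT => H.
have /choice[p pP] : forall n : nat, exists p : R * R, [/\ `|p.1| <= N, `|p.2| <= N,
    `|p.1 - p.2| <= n.+1%:R^-1 & u p.1 * u p.2 + v p.1 * v p.2 <= 0].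
  move=> n; apply: contrapT => Hn; apply: H; exists n => s t sN tN st.
  rewrite ltNge; apply/negP => le0; apply: Hn; by exists (s, t).
(* At a cluster point of the bad pairs both members of a pair would be close
to s, where the inner product is close to 1. *)
have [s ps] : exists s : R, cluster ((fun n => (p n).1) @ \oo) s.
  have [|s [_ ps]] := @segment_compact R (- N) N ((fun n => (p n).1) @ \oo) _; last by exists s.
  by apply: (@filterE _ \oo) => n /=; have [h _ _ _] := pP n; rewrite in_itv/= -ler_norml.
have cus : \forall x \near s, `|u s - u x| < 1 / 4.
  by have /cvgrPdist_lt := @cu s; apply; lra.
have cvs : \forall x \near s, `|v s - v x| < 1 / 4.
  by have /cvgrPdist_lt := @cv s; apply; lra.
have : \forall x \near s, `|u s - u x| < 1 / 4 /\ `|v s - v x| < 1 / 4.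
  by near=> x; split; near: x.
move=> /nbhs_ballP[d /= d0 near_s].
have d2 : 0 < d / 2 by rewrite divr_gt0.
have [K _ KP] := near_infty_natSinv_lt (PosNum d2).
have [_ [[n /= Kn <-] sn]] := ps [set (p n).1 | n in [set n | (K <= n)%N]] (ball s (d / 2))
  (ex_intro2 _ _ K I (fun n Kn => ex_intro2 _ _ n Kn erefl)) (nbhsx_ballx _ _ d2).
have [_ _ p12 ple] := pP n; have nd := KP _ Kn; rewrite /= in nd.
rewrite /ball/= in sn.
have [|us1 vs1] := near_s (p n).1; first by rewrite /ball/=; lra.
have [|us2 vs2] := near_s (p n).2.
  rewrite /ball/= (_ : s - _ = (s - (p n).1) + ((p n).1 - (p n).2)); last by ring.
  apply: le_lt_trans (ler_normD _ _) _.
  by rewrite [ltRHS]splitr ltrD// (le_lt_trans p12).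
have e1 := uv1 (p n).1; have e2 := uv1 (p n).2.
rewrite ltr_norml in us1; rewrite ltr_norml in us2.
rewrite ltr_norml in vs1; rewrite ltr_norml in vs2.
have hu : (u (p n).1 - u (p n).2) ^+ 2 <= 1 / 4.
  move: us1 us2 => /andP[? ?] /andP[? ?]; nra.
have hv : (v (p n).1 - v (p n).2) ^+ 2 <= 1 / 4.
  move: vs1 vs2 => /andP[? ?] /andP[? ?]; nra.
nra.
Unshelve. all: by end_near.
Qed.

(** Cosine and, below, sine of the oriented angle from the point (u s, v s) of
the unit circle to the point (u t, v t). *)
Definition arc_cos s t := u s * u t + v s * v t.
Definition arc_sin s t := u s * v t - v s * u t.

Lemma arc_sqr s t : arc_cos s t ^+ 2 + arc_sin s t ^+ 2 = 1.
Proof.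
rewrite (_ : _ + _ = (u s ^+ 2 + v s ^+ 2) * (u t ^+ 2 + v t ^+ 2)).
  by rewrite !uv1 mulr1.
by rewrite /arc_cos /arc_sin; ring.
Qed.

Lemma cos_arc s t : 0 < arc_cos s t -> cos (atan (arc_sin s t / arc_cos s t)) = arc_cos s t.
Proof.
move=> c0; rewrite cos_atan; have cn := lt0r_neq0 c0.
rewrite (_ : 1 + _ = (arc_cos s t)^-1 ^+ 2).
  by rewrite sqrtr_sqr gtr0_norm ?invr_gt0// invrK.
transitivity ((arc_cos s t ^+ 2 + arc_sin s t ^+ 2) / arc_cos s t ^+ 2); first by field.
by rewrite arc_sqr mul1r exprVn.
Qed.

Lemma sin_arc s t : 0 < arc_cos s t -> sin (atan (arc_sin s t / arc_cos s t)) = arc_sin s t.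
Proof.
move=> c0; have c1 := cos_arc c0.
have cn : arc_cos s t != 0 by rewrite lt0r_neq0.
have := atanK (arc_sin s t / arc_cos s t); rewrite /tan c1.
by move=> /(congr1 ( *%R^~ (arc_cos s t))); rewrite !divfK.
Qed.

Lemma continuous_arc (p q : R -> R) : continuous p -> continuous q ->
  (forall t, 0 < arc_cos (p t) (q t)) ->
  continuous (fun t => atan (arc_sin (p t) (q t) / arc_cos (p t) (q t))).
Proof.
move=> cp cq pq t.
have cup : continuous (u \o p) by move=> x; apply: continuous_comp; [exact: cp|exact: cu].
have cvp : continuous (v \o p) by move=> x; apply: continuous_comp; [exact: cp|exact: cv].
have cuq : continuous (u \o q) by move=> x; apply: continuous_comp; [exact: cq|exact: cu].
have cvq : continuous (v \o q) by move=> x; apply: continuous_comp; [exact: cq|exact: cv].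
apply: continuous_comp; last exact: continuous_atan.
apply: cvgM.
  by apply: cvgB; apply: cvgM; [exact: cup|exact: cvq|exact: cvp|exact: cuq].
apply: cvgV; first by rewrite lt0r_neq0.
by apply: cvgD; apply: cvgM; [exact: cup|exact: cuq|exact: cvp|exact: cvq].
Qed.

(** The segment from 0 to t is cut into M equal steps, so short that each turns
the curve by less than pi/2. The angle of a single step is then an arctangent,
hence continuous in t, and the argument is the sum of the M angles. *)
Lemma local_argument (N : R) : 0 <= N -> exists A, [/\ continuous A, A 0 = 0 &
  forall t, `|t| <= N -> cos (A t) = u t /\ sin (A t) = v t].
Proof.
move=> N0; have [n nP] := short_arcs N.
pose M := (Num.truncn (N * n.+1%:R)).+1.
have M0 : 0 < M%:R :> R by [].
have NM : N / M%:R <= n.+1%:R^-1.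
  by rewrite ler_pdivrMr// ler_pdivlMl// mulrC; apply/ltW/truncnS_gt.
(* The map cl clips t to [-N, N], so that the steps stay short for every t. *)
pose cl t := (`|t + N| - `|t - N|) / 2.
have clN t : `|cl t| <= N.
  rewrite normrM normfV (@ger0_norm _ 2)// ler_pdivrMr//.
  have e1 : t + N - (t - N) = N * 2 by ring.
  have e2 : t - N - (t + N) = - (N * 2) by ring.
  have h1 := lerB_dist (t + N) (t - N); have h2 := lerB_dist (t - N) (t + N).
  have N2 : `|N * 2| = N * 2 by rewrite ger0_norm ?mulr_ge0.
  rewrite e1 N2 in h1; rewrite e2 normrN N2 in h2.
  by rewrite ler_norml lerNl opprB h1 h2.
have ccl : continuous cl.
  move=> t; apply: cvgM; last exact: cvg_cst.
  have h (c : R) : `|y + c| @[y --> t] --> `|t + c|.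
    by apply: cvg_norm; apply: cvgD; [exact: cvg_id|exact: cvg_cst].
  by apply: cvgB; exact: h.
have cl0 : cl 0 = 0 by rewrite /cl add0r sub0r normrN subrr mul0r.
have clE t : `|t| <= N -> cl t = t.
  rewrite ler_norml => /andP[Nt tN]; rewrite /cl ger0_norm ?ler0_norm ?subr_le0//; first by field.
  by rewrite -[N]opprK subr_ge0.
pose p k t := cl t * (k%:R / M%:R).
have cp k : continuous (p k) by move=> t; apply: cvgM; [exact: ccl|exact: cvg_cst].
have pN k t : (k <= M)%N -> `|p k t| <= N.
  move=> kM; rewrite normrM -[leRHS]mulr1 ler_pM//.
  by rewrite ger0_norm ?divr_ge0// ler_pdivrMr// mul1r ler_nat.
have pp k t : (k < M)%N -> 0 < arc_cos (p k t) (p k.+1 t).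
  move=> kM; apply: nP; [exact/pN/ltnW|exact: pN|apply: le_trans NM].
  rewrite (_ : _ - _ = - (cl t / M%:R)); last by rewrite /p -natr1; ring.
  by rewrite normrN normrM normfV (gtr0_norm M0) ler_pM2r ?invr_gt0.
pose A j t := \sum_(0 <= k < j) atan (arc_sin (p k t) (p k.+1 t) / arc_cos (p k t) (p k.+1 t)).
have AP j : (j <= M)%N -> continuous (A j) /\
    forall t, cos (A j t) = u (p j t) /\ sin (A j t) = v (p j t).
  elim: j => [_|j IH jM].
    split=> [t|t]; last by rewrite /A big_nil cos0 sin0 /p mul0r mulr0 u0 v0.
    by rewrite /A; under eq_fun do rewrite big_nil; exact: cvg_cst.
  have [cA EA] := IH (ltnW jM); split => t.
    rewrite /A; under eq_fun do rewrite big_nat_recr//=.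
    apply: cvgD; first exact: cA.
    by apply: continuous_arc => // x; exact: pp.
  have [cE sE] := EA t.
  rewrite /A big_nat_recr//= -/(A j t) cosD sinD cE sE cos_arc ?pp// sin_arc ?pp//.
  have := uv1 (p j t); rewrite /arc_cos /arc_sin => e.
  split.
  - rewrite (_ : _ - _ = (u (p j t) ^+ 2 + v (p j t) ^+ 2) * u (p j.+1 t)); last by ring.
    by rewrite e mul1r.
  - rewrite (_ : _ + _ = (u (p j t) ^+ 2 + v (p j t) ^+ 2) * v (p j.+1 t)); last by ring.
    by rewrite e mul1r.
have [cA EA] := AP M (leqnn M).
exists (A M); split => //.
  have p0 k : p k 0 = 0 by rewrite /p cl0 mul0r.
  rewrite /A big1// => k _; rewrite !p0 (_ : arc_sin 0 0 = 0) ?mul0r ?atan0//.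
  by rewrite /arc_sin; ring.
move=> t tN; have := EA t; rewrite /p divff ?lt0r_neq0// mulr1.
by rewrite (clE _ tN).
Qed.

(** Local arguments on [-n, n] agree by uniqueness, so they glue. *)
Lemma argument_exists : exists A, [/\ continuous A, A 0 = 0 &
  forall t, cos (A t) = u t /\ sin (A t) = v t].
Proof.
have /choice[A_ AP] : forall n : nat, exists A, [/\ continuous A, A 0 = 0 &
    forall t, `|t| <= n%:R -> cos (A t) = u t /\ sin (A t) = v t].
  by move=> n; apply: local_argument.
pose A t := A_ (Num.truncn `|t|).+1 t.
have AE (n : nat) t : `|t| <= n%:R -> A t = A_ n t.
  move=> tn; have tN : `|t| <= (Num.truncn `|t|).+1%:R by apply/ltW/truncnS_gt.
  have [c1 z1 E1] := AP n; have [c2 z2 E2] := AP (Num.truncn `|t|).+1.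
  apply: (@argument_unique (A_ (Num.truncn `|t|).+1) (A_ n) `|t|) => //; first by rewrite z1 z2.
  move=> s st; have [-> ->] := E1 s (le_trans st tn).
  by have [-> ->] := E2 s (le_trans st tN).
exists A; split.
- move=> t; have tN : `|t| < (Num.truncn `|t|).+1%:R by exact: truncnS_gt.
  have [cN _ _] := AP (Num.truncn `|t|).+1.
  have e : {near t, A_ (Num.truncn `|t|).+1 =1 A}.
    near=> y; rewrite (AE (Num.truncn `|t|).+1)//; apply/ltW.
    near: y; apply: (cvgr_lt `|t|) => //; exact: norm_continuous.
  rewrite /continuous_at -(nbhs_singleton e).
  apply: cvg_trans (near_eq_cvg e) _; exact: cN.
- by rewrite (AE 0%N) ?normr0//; have [_ -> _] := AP 0%N.
- move=> t; have tN : `|t| <= (Num.truncn `|t|).+1%:R by apply/ltW/truncnS_gt.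
  by rewrite (AE _ _ tN); have [_ _ E] := AP (Num.truncn `|t|).+1; exact: E.
Unshelve. all: by end_near.
Qed.

End ContinuousArgument.

(** * The distinguished logarithm and its second differences *)

Section DistinguishedLogarithm.
Context {R : realType}.
Context (f : R -> R[i]).
Hypothesis f_continuous : continuous (f : R -> R[i]^o).

Lemma continuous_part (g : R[i] -> R) : (forall z w, g (z - w) = g z - g w) ->
  (forall z, `|g z| <= modulus z) -> continuous (fun t => g (f t)).
Proof.
move=> gB gle t; apply/cvgrPdist_lt => e e0.
have e0c : 0 < e%:C :> R[i] by rewrite ltcR.
have /cvgrPdist_lt/(_ _ e0c) := @f_continuous t.
apply: filterS => y; rewrite (_ : `|f t - f y| = (modulus (f t - f y))%:C) ?ltcR
  => [h|]; last first.
  by case: (f t - f y).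
by rewrite -gB; apply: le_lt_trans (gle _) h.
Qed.

Lemma continuous_Re : continuous (fun t => complex.Re (f t)).
Proof. by apply: continuous_part => [[? ?] [? ?]//|z]; exact: Re_le_modulus. Qed.

Lemma continuous_Im : continuous (fun t => complex.Im (f t)).
Proof. by apply: continuous_part => [[? ?] [? ?]//|z]; exact: Im_le_modulus. Qed.

Lemma continuous_modulus : continuous (fun t => modulus (f t)).
Proof.
move=> t; rewrite (_ : (fun t => modulus (f t)) =
    (fun t => Num.sqrt (complex.Re (f t) ^+ 2 + complex.Im (f t) ^+ 2))); last first.
  by apply/funext => s; rewrite -modulus_sqr sqrtr_sqr ger0_norm ?modulus_ge0.
apply: continuous_comp; last exact: sqrt_continuous.
apply: cvgD.
- apply: (@continuous_comp _ _ _ (fun t => complex.Re (f t)) (fun y : R => y ^+ 2)).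
    exact: continuous_Re.
  exact: exprn_continuous.
- apply: (@continuous_comp _ _ _ (fun t => complex.Im (f t)) (fun y : R => y ^+ 2)).
    exact: continuous_Im.
  exact: exprn_continuous.
Qed.

Hypothesis f_0 : f 0 = 1.
Hypothesis f_neq0 : forall t, f t != 0.

Lemma modulus_gt0 t : 0 < modulus (f t).
Proof.
rewrite lt0r modulus_ge0 andbT; apply/eqP => h; have := f_neq0 t.
by rewrite (ComplexField.Normc.eq0_normc h) eqxx.
Qed.

(** The argument is chosen by description among the continuous ones, so its
properties rest on the existence of one, for f divided by its modulus. *)
Lemma is_Arg_Arg : is_Arg f (Arg f).
Proof.
apply: getPex.
pose m t := modulus (f t).
have m0 t : m t != 0 by rewrite gt_eqF// modulus_gt0.
have cm : continuous (fun t => (m t)^-1).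
  by move=> t; apply: cvgV; [exact: m0|exact: continuous_modulus].
have [|||||A [cA A0 AE]] := @argument_exists R
    (fun t => complex.Re (f t) * (m t)^-1) (fun t => complex.Im (f t) * (m t)^-1).
- by move=> t; apply: cvgM; [exact: continuous_Re|exact: cm].
- by move=> t; apply: cvgM; [exact: continuous_Im|exact: cm].
- by move=> t; rewrite -[RHS](expr1n _ 2) -(mulfV (m0 t)) [RHS]exprMn modulus_sqr; ring.
- by rewrite /m f_0 (modulus_real 1) normr1 invr1 mulr1.
- by rewrite f_0 mul0r.
exists A; split => // t; have [cE sE] := AE t.
rewrite -[modulus (f t)]/(m t); apply: complexP; rewrite /= expR0 cE sE; by field; exact: m0.
Qed.

Lemma expC_Ln t : f t = expC (Ln f t).
Proof.
have [_ _ E] := is_Arg_Arg.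
rewrite {1}E; apply: complexP; rewrite /= lnK ?posrE ?modulus_gt0// expR0; ring.
Qed.

Lemma Ln_0 : Ln f 0 = 0.
Proof. by rewrite /Ln f_0 (modulus_real 1) normr1 ln1; have [_ -> _] := is_Arg_Arg. Qed.

Lemma continuous_ReLn : continuous (fun t => complex.Re (Ln f t)).
Proof.
move=> t; apply: continuous_comp; first exact: continuous_modulus.
by apply: continuous_ln; exact: modulus_gt0.
Qed.

Lemma continuous_ImLn : continuous (fun t => complex.Im (Ln f t)).
Proof. by have [c _ _] := is_Arg_Arg. Qed.

End DistinguishedLogarithm.

Section SecondDifferences.
Context {R : realType}.
Implicit Types (D : R -> R) (h t : R).

Definition half_difference D t h := D t - (D (t - h) + D (t + h)) / 2.

Lemma first_difference_sum D h n : D 0 = 0 ->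
  D (n.+1%:R * h) - D (n%:R * h) =
  D h - 2 * \sum_(0 <= k < n) half_difference D (k.+1%:R * h) h.
Proof.
move=> D0; elim: n => [|n IH]; first by rewrite big_nil mul1r mul0r D0 mulr0.
rewrite big_nat_recr//= mulrDr opprD addrA -IH /half_difference.
have e1 : n.+1%:R * h - h = n%:R * h by rewrite -natr1 mulrDl mul1r addrK.
have e2 : n.+1%:R * h + h = n.+2%:R * h by rewrite -[n.+2%:R]natr1 mulrDl mul1r.
by rewrite e1 e2; field.
Qed.

(** Summation by parts, applied twice. *)
Lemma second_difference_sum D h n : D 0 = 0 ->
  D (n.+1%:R * h) = n.+1%:R * D h -
    2 * \sum_(0 <= k < n) (n - k)%:R * half_difference D (k.+1%:R * h) h.
Proof.
move=> D0; elim: n => [|n IH]; first by rewrite big_nil mulr0 subr0 !mul1r.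
have E : \sum_(0 <= k < n.+1) (n.+1 - k)%:R * half_difference D (k.+1%:R * h) h =
    \sum_(0 <= k < n) (n - k)%:R * half_difference D (k.+1%:R * h) h +
    \sum_(0 <= k < n.+1) half_difference D (k.+1%:R * h) h.
  rewrite (_ : \sum_(0 <= k < n) _ =
      \sum_(0 <= k < n.+1) (n - k)%:R * half_difference D (k.+1%:R * h) h); last first.
    by rewrite [RHS]big_nat_recr//= subnn mul0r addr0.
  rewrite -big_split/= big_nat [RHS]big_nat; apply: eq_bigr => k /andP[_ kn].
  by rewrite ltnS in kn; rewrite subSn// -natr1; ring.
have := first_difference_sum h n.+1 D0.
move=> /eqP; rewrite subr_eq => /eqP ->; rewrite IH E -[n.+2%:R]natr1; ring.
Qed.

Lemma weighted_sum_recl D h n :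
  \sum_(0 <= k < n.+1) (n.+1 - k)%:R * `|half_difference D (k%:R * h) h| =
  n.+1%:R * `|half_difference D 0 h| +
  \sum_(0 <= k < n) (n - k)%:R * `|half_difference D (k.+1%:R * h) h|.
Proof. by rewrite big_nat_recl// subn0 mul0r. Qed.

Lemma norm_weighted_sum D h n :
  `|\sum_(0 <= k < n) (n - k)%:R * half_difference D (k.+1%:R * h) h| <=
  \sum_(0 <= k < n) (n - k)%:R * `|half_difference D (k.+1%:R * h) h|.
Proof.
apply: le_trans (ler_norm_sum _ _ _) _; apply: ler_sum => k _.
by rewrite normrM normr_nat.
Qed.

Lemma second_difference_bound D h n : D 0 = 0 ->
  `|D (n%:R * h) - n%:R * D h| <=
    2 * \sum_(0 <= k < n) (n - k)%:R * `|half_difference D (k%:R * h) h|.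
Proof.
move=> D0; case: n => [|n]; first by rewrite !mul0r D0 subrr normr0 big_nil mulr0.
rewrite second_difference_sum// addrAC subrr add0r normrN normrM (@ger0_norm _ 2)//.
rewrite ler_wpM2l// weighted_sum_recl (le_trans (norm_weighted_sum _ _ _))//.
by rewrite lerDr mulr_ge0.
Qed.

(** When D(-h) = D(h) and D 0 = 0, the half second difference at 0 is -D(h), so
the term k = 0 of the sum pays for n D(h). *)
Lemma second_difference_even_bound D h n : D 0 = 0 -> D (- h) = D h ->
  `|D (n%:R * h)| <=
    2 * \sum_(0 <= k < n) (n - k)%:R * `|half_difference D (k%:R * h) h|.
Proof.
move=> D0 Dh; case: n => [|n]; first by rewrite !mul0r D0 normr0 big_nil mulr0.
have d0 : half_difference D 0 h = - D h.
  by rewrite /half_difference D0 !sub0r Dh add0r; field.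
rewrite second_difference_sum// weighted_sum_recl d0 normrN.
have := norm_weighted_sum D h n.
set S := \sum_(0 <= k < n) (n - k)%:R * half_difference D (k.+1%:R * h) h.
set T := \sum_(0 <= k < n) (n - k)%:R * `|half_difference D (k.+1%:R * h) h|.
move=> ST.
apply: le_trans (ler_normB _ _) _; rewrite !normrM normr_nat (@ger0_norm _ 2)//.
rewrite mulrDr lerD ?ler_wpM2l// mulrA ler_wpM2r// mulr_natl mulr2n lerDl//.
Qed.

Context (h_ : nat -> R).
Hypothesis h_gt0 : forall l, 0 < h_ l.
Hypothesis h_cvg0 : h_ l @[l --> \oo] --> (0 : R).

Lemma truncn_mul_cvg t : 0 < t -> (Num.truncn (t / h_ l))%:R * h_ l @[l --> \oo] --> t.
Proof.
move=> t0; apply/cvgrPdist_le => e e0; near=> l.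
have hl := h_gt0 l.
have /andP[h1 h2] := truncn_itv (ltW (divr_gt0 t0 hl)).
have he : h_ l <= e by near: l; exact: (cvgr_le _ h_cvg0).
rewrite ler_pdivlMr// in h1; rewrite ltr_pdivrMr// -natr1 mulrDl mul1r in h2.
by rewrite ger0_norm ?subr_ge0//; lra.
Unshelve. all: by end_near.
Qed.

Context (D : R -> R) (eps : R -> nat -> R).
Hypothesis D_cont : continuous D.
Hypothesis eps_cvg0 : forall t, 0 < t -> eps t l @[l --> \oo] --> (0 : R).

Lemma vanishing_limit :
  (forall t l, 0 < t -> `|D ((Num.truncn (t / h_ l))%:R * h_ l)| <= eps t l) ->
  forall t, 0 < t -> D t = 0.
Proof.
move=> H t t0.
have c1 : D ((Num.truncn (t / h_ l))%:R * h_ l) @[l --> \oo] --> D t.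
  exact: (cvg_comp _ _ (truncn_mul_cvg t0) (@D_cont t)).
have c2 : D ((Num.truncn (t / h_ l))%:R * h_ l) @[l --> \oo] --> (0 : R).
  apply/cvgr0Pnorm_le => e e0; near=> l; apply: le_trans (H t l t0) _.
  by near: l; exact: (cvgr_le _ (eps_cvg0 t0)).
exact: (cvg_unique _ c1 c2).
Unshelve. all: by end_near.
Qed.

(** Along n h -> t, D(n h) tends to D t, and D(n h) is close to n D(h). The
same holds with t = 1, and the ratio of the two values of n tends to t. *)
Lemma linear_limit :
  (forall t l, 0 < t -> let n := Num.truncn (t / h_ l) in
     `|D (n%:R * h_ l) - n%:R * D (h_ l)| <= eps t l) ->
  forall t, 0 < t -> D t = t * D 1.
Proof.
move=> H t t0.
have lim s : 0 < s -> (Num.truncn (s / h_ l))%:R * D (h_ l) @[l --> \oo] --> D s.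
  move=> s0.
  have c1 : D ((Num.truncn (s / h_ l))%:R * h_ l) @[l --> \oo] --> D s.
    exact: (cvg_comp _ _ (truncn_mul_cvg s0) (@D_cont s)).
  apply/cvgrPdist_le => e e0; have e2 : 0 < e / 2 by rewrite divr_gt0.
  near=> l.
  have g1 : `|D s - D ((Num.truncn (s / h_ l))%:R * h_ l)| <= e / 2.
    by near: l; move/cvgrPdist_le : c1 => /(_ _ e2).
  have g2 : eps s l <= e / 2 by near: l; exact: (cvgr_le _ (eps_cvg0 s0)).
  have g3 := H s l s0; rewrite /= in g3.
  rewrite -[D s](subrK (D ((Num.truncn (s / h_ l))%:R * h_ l))) -addrA.
  rewrite [leRHS]splitr; apply: le_trans (ler_normD _ _) _.
  by rewrite lerD// (le_trans g3).
have c1 := truncn_mul_cvg (@ltr01 R); have ct := truncn_mul_cvg t0.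
(* The ratio of the two integer parts, written through t and 1. *)
have c : (Num.truncn (t / h_ l))%:R * h_ l * ((Num.truncn (1 / h_ l))%:R * h_ l)^-1 *
    ((Num.truncn (1 / h_ l))%:R * D (h_ l)) @[l --> \oo] --> t * D 1.
  have -> : t * D 1 = t * 1^-1 * D 1 by rewrite invr1 mulr1.
  apply: cvgM; last exact: lim.
  by apply: cvgM; [exact: ct|apply: cvgV; [exact: oner_neq0|exact: c1]].
suff e : {near \oo, (fun l => (Num.truncn (t / h_ l))%:R * h_ l *
    ((Num.truncn (1 / h_ l))%:R * h_ l)^-1 * ((Num.truncn (1 / h_ l))%:R * D (h_ l)))
    =1 (fun l => (Num.truncn (t / h_ l))%:R * D (h_ l))}.
  exact: (cvg_unique _ (lim t t0) (cvg_trans (near_eq_cvg e) c)).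
near=> l.
have : (Num.truncn (1 / h_ l))%:R * h_ l != 0.
  by near: l; exact: (cvgr_neq0 _ c1 (oner_neq0 _)).
rewrite mulf_eq0 negb_or => /andP[na nb].
by field; rewrite na nb.
Unshelve. all: by end_near.
Qed.

End SecondDifferences.

(** * The canonical representation of f *)

Section CosIntegrand.
Context {R : realType}.
Implicit Types t h x : R.

(** The addition formula for cos ((t - h) x) + cos ((t + h) x) brings out the
factor 1 - cos (h x). This, with its imaginary counterpart, is why the
hypothesis concerns second differences of the logarithm. *)
Lemma Re_cos_integrand t h x :
  complex.Re (cos_integrand t h x) = half_difference (kernelRe ^~ x) t h.
Proof.
rewrite /cos_integrand /half_difference /kernelRe; case: eqP => /= [->|/eqP x0].
  by rewrite mulr0 expR0 cos0 sin0; field.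
have e1 : (t - h) * x = t * x - h * x by ring.
have e2 : (t + h) * x = t * x + h * x by ring.
by rewrite expR0 e1 e2 cosB cosD; field.
Qed.

Lemma Im_cos_integrand t h x :
  complex.Im (cos_integrand t h x) = half_difference (kernelIm ^~ x) t h.
Proof.
rewrite /cos_integrand /half_difference /kernelIm; case: eqP => /= [->|/eqP x0].
  by rewrite (mulr0 t) expR0 cos0 sin0; field.
have e1 : (t - h) * x = t * x - h * x by ring.
have e2 : (t + h) * x = t * x + h * x by ring.
by rewrite expR0 e1 e2 sinB sinD; field.
Qed.

Lemma Rintegral_half_difference (K : {measure set (measurableTypeR R) -> \bar R})
    (k : R -> R -> R) t h :
  (forall t, K.-integrable setT (EFin \o k t)) ->
  \int[K]_x half_difference (k ^~ x) t h =
  half_difference (fun t => \int[K]_x k t x) t h.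
Proof.
move=> ik; rewrite /half_difference.
have i2 := integrable_addR (ik (t - h)) (ik (t + h)).
rewrite (RintegralB measurableT (ik t) (integrable_ZrR 2^-1 i2)).
by rewrite (RintegralZr _ measurableT i2) (RintegralD measurableT (ik _) (ik _)).
Qed.

Lemma Rintegral_Re_cos (K : {measure set (measurableTypeR R) -> \bar R}) t h :
  (K setT < +oo)%E ->
  \int[K]_x complex.Re (cos_integrand t h x) =
  half_difference (fun t => \int[K]_x kernelRe t x) t h.
Proof.
move=> Kfin; rewrite -(Rintegral_half_difference t h (integrable_kernelRe Kfin)).
by apply: eq_Rintegral => x _; exact: Re_cos_integrand.
Qed.

Lemma Rintegral_Im_cos (K : {measure set (measurableTypeR R) -> \bar R}) t h :
  (K setT < +oo)%E ->
  \int[K]_x complex.Im (cos_integrand t h x) =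
  half_difference (fun t => \int[K]_x kernelIm t x) t h.
Proof.
move=> Kfin; rewrite -(Rintegral_half_difference t h (integrable_kernelIm Kfin)).
by apply: eq_Rintegral => x _; exact: Im_cos_integrand.
Qed.

Lemma half_differenceB (D E : R -> R) t h :
  half_difference (fun t => D t - E t) t h = half_difference D t h - half_difference E t h.
Proof. by rewrite /half_difference; field. Qed.

Context (G : classV R).
Notation Kp := (lebesgue_stieltjes_measure (positive_variation G)).
Notation Kn := (lebesgue_stieltjes_measure (negative_variation G)).

Lemma Re_LS_sin t : complex.Re (LS_integral G (sin_integrand t)) =
  \int[Kp]_x kernelRe t x - \int[Kn]_x kernelRe t x.
Proof. by rewrite /LS_integral !integralC_sin_integrand. Qed.

Lemma Im_LS_sin t : complex.Im (LS_integral G (sin_integrand t)) =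
  \int[Kp]_x kernelIm t x - \int[Kn]_x kernelIm t x.
Proof. by rewrite /LS_integral !integralC_sin_integrand. Qed.

Lemma continuous_Re_LS_sin :
  continuous (fun t => complex.Re (LS_integral G (sin_integrand t))).
Proof.
rewrite (funext Re_LS_sin) => t.
by apply: cvgB; apply: continuous_int_kernelRe;
  [exact: positive_variation_measure_lty|exact: negative_variation_measure_lty].
Qed.

Lemma continuous_Im_LS_sin :
  continuous (fun t => complex.Im (LS_integral G (sin_integrand t))).
Proof.
rewrite (funext Im_LS_sin) => t.
by apply: cvgB; apply: continuous_int_kernelIm;
  [exact: positive_variation_measure_lty|exact: negative_variation_measure_lty].
Qed.

Lemma LS_sin0 : LS_integral G (sin_integrand 0) = 0.
Proof.
apply: complexP; rewrite ?Re_LS_sin ?Im_LS_sin /=.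
  under eq_Rintegral do rewrite /kernelRe expr0n/= mul0r oppr0 mul0r cos0 subrr mul0r if_same.
  under [X in _ - X]eq_Rintegral do
    rewrite /kernelRe expr0n/= mul0r oppr0 mul0r cos0 subrr mul0r if_same.
  by rewrite !Rintegral_cst// !mul0r subrr.
under eq_Rintegral do rewrite /kernelIm !mul0r sin0 subrr mul0r if_same.
under [X in _ - X]eq_Rintegral do rewrite /kernelIm !mul0r sin0 subrr mul0r if_same.
by rewrite !Rintegral_cst// !mul0r subrr.
Qed.

Lemma kernelReN t x : kernelRe (- t) x = kernelRe t x.
Proof. by rewrite /kernelRe sqrrN mulNr cosN. Qed.

Lemma kernelImN t x : kernelIm (- t) x = - kernelIm t x.
Proof. by rewrite /kernelIm; case: eqP => _; rewrite ?oppr0// !mulNr sinN; ring. Qed.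

Lemma LS_sinN t : LS_integral G (sin_integrand (- t)) =
  conjc (LS_integral G (sin_integrand t)).
Proof.
have N (K : {measure set (measurableTypeR R) -> \bar R}) : (K setT < +oo)%E ->
    \int[K]_x kernelIm (- t) x = - \int[K]_x kernelIm t x.
  move=> Kfin; transitivity (\int[K]_x (-1 * kernelIm t x)).
    by apply: eq_Rintegral => x _; rewrite kernelImN mulN1r.
  by rewrite (RintegralZl _ measurableT (integrable_kernelIm Kfin t)) mulN1r.
apply: complexP; rewrite ?Re_conj ?Im_conj ?Re_LS_sin ?Im_LS_sin.
  congr (_ - _); apply: eq_Rintegral => x _; exact: kernelReN.
rewrite (N _ (positive_variation_measure_lty G)) (N _ (negative_variation_measure_lty G)).
by rewrite opprB addrC opprK.
Qed.

(** The centring t sin x cancels sin (t x) at t = 1; this is what makes the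
drift equal to the argument of f at 1. *)
Lemma Im_LS_sin1 : complex.Im (LS_integral G (sin_integrand 1)) = 0.
Proof.
have z x : kernelIm 1 x = 0 :> R by rewrite /kernelIm !mul1r subrr mul0r if_same.
rewrite Im_LS_sin; under eq_Rintegral do rewrite z.
under [X in _ - X]eq_Rintegral do rewrite z.
by rewrite !Rintegral_cst// !mul0r subrr.
Qed.

Lemma Re_LS_cos t h : complex.Re (LS_integral G (cos_integrand t h)) =
  half_difference (fun t => complex.Re (LS_integral G (sin_integrand t))) t h.
Proof.
rewrite (funext Re_LS_sin) half_differenceB.
congr (_ - _).
  by apply: Rintegral_Re_cos; exact: positive_variation_measure_lty.
by apply: Rintegral_Re_cos; exact: negative_variation_measure_lty.
Qed.

Lemma Im_LS_cos t h : complex.Im (LS_integral G (cos_integrand t h)) =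
  half_difference (fun t => complex.Im (LS_integral G (sin_integrand t))) t h.
Proof.
rewrite (funext Im_LS_sin) half_differenceB.
congr (_ - _).
  by apply: Rintegral_Im_cos; exact: positive_variation_measure_lty.
by apply: Rintegral_Im_cos; exact: negative_variation_measure_lty.
Qed.

End CosIntegrand.

Section Psi.
Context {R : realType}.
Implicit Types f : R -> R[i].

Lemma complex_half : 2^-1 = (2^-1 : R)%:C :> R[i].
Proof. by apply: complexP => /=; field. Qed.

Lemma Re_psi f t h : complex.Re (psi f t h) = half_difference (fun t => complex.Re (Ln f t)) t h.
Proof. by rewrite /psi complex_half /half_difference /=; field. Qed.

Lemma Im_psi f t h : complex.Im (psi f t h) = half_difference (fun t => complex.Im (Ln f t)) t h.
Proof. by rewrite /psi complex_half /half_difference /=; field. Qed.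

Lemma expC_conj (z : R[i]) : expC (conjc z) = conjc (expC z).
Proof. by case: z => a b; apply: complexP; rewrite /= ?cosN ?sinN; ring. Qed.

Lemma modulus_conj (z : R[i]) : modulus (conjc z) = modulus z.
Proof. by case: z => a b; rewrite /modulus/= sqrrN. Qed.

Lemma charfunN (F : distribution_function R) t : charfun F (- t) = conjc (charfun F t).
Proof.
rewrite !charfunE; apply: complexP => /=.
  by apply: eq_Rintegral => x _; rewrite mulNr cosN.
transitivity (\int[lebesgue_stieltjes_measure F]_x (-1 * sin (t * x))).
  by apply: eq_Rintegral => x _; rewrite mulN1r mulNr sinN.
by rewrite (RintegralZl _ measurableT (integrable_sinM F t)) mulN1r.
Qed.

End Psi.

Theorem theorem1 (R : realType) (f : R -> R[i])
    (f_continuous : continuous (f : R -> R[i]^o))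
    (f_0 : f 0 = 1)
    (f_neq0 : forall t : R, f t != 0)
    (I delta : R -> R -> R[i])
    (psiE : forall t h : R, 0 <= t -> 0 < h -> psi f t h = I t h + delta t h)
    (G : classV R)
    (IE : forall t h : R, 0 <= t -> 0 < h ->
       I t h = LS_integral G (cos_integrand t h))
    (h_ : nat -> R)
    (h_gt0 : forall l : nat, 0 < h_ l)
    (h_cvg0 : h_ l @[l --> \oo] --> (0 : R))
    (delta_cvg0 : forall t : R, 0 < t ->
       (let n := Num.truncn (t / h_ l) in
        \sum_(0 <= k < n) (n - k)%:R * modulus (delta (k%:R * h_ l) (h_ l)))
         @[l --> \oo] --> (0 : R)) :
  ((forall t : R, f (- t) = conjc (f t)) ->
   forall t : R,
     f t = expC (0 +i* (t * Arg f 1) + LS_integral G (sin_integrand t)))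
  /\
  (forall F : distribution_function R,
     (forall t : R, f t = charfun F t) -> classQ F).
Proof.
suff main : (forall t : R, f (- t) = conjc (f t)) ->
    forall t : R, f t = expC (0 +i* (t * Arg f 1) + LS_integral G (sin_integrand t)).
  split=> // F fF; apply: (@levy_khintchine_classQ _ G _ (Arg f 1)) => t.
  by rewrite -fF main// => s; rewrite !fF charfunN.
move=> f_conj.
(* The real part DR and the imaginary part DI of Ln f - E have the real and
imaginary parts of delta as their half second differences on t >= 0. *)
pose E t := LS_integral G (sin_integrand t).
have E0 : E 0 = 0 by exact: LS_sin0.
pose DR t := complex.Re (Ln f t) - complex.Re (E t).
pose DI t := complex.Im (Ln f t) - complex.Im (E t).
have L0 := Ln_0 f_continuous f_0 f_neq0.
have DR0 : DR 0 = 0 by rewrite /DR L0 E0 subrr.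
have DI0 : DI 0 = 0 by rewrite /DI L0 E0 subrr.
have dR t h : 0 <= t -> 0 < h -> half_difference DR t h = complex.Re (delta t h).
  move=> t0 h0; rewrite half_differenceB -Re_psi -Re_LS_cos -IE// psiE// Re_add.
  by rewrite addrC addKr.
have dI t h : 0 <= t -> 0 < h -> half_difference DI t h = complex.Im (delta t h).
  move=> t0 h0; rewrite half_differenceB -Im_psi -Im_LS_cos -IE// psiE// Im_add.
  by rewrite addrC addKr.
have DRN h : DR (- h) = DR h.
  by rewrite /DR /E LS_sinN Re_conj /Ln /= f_conj modulus_conj.
(* The factor 2 is that of the summation by parts. *)
pose eps t l := 2 * (let n := Num.truncn (t / h_ l) in
  \sum_(0 <= k < n) (n - k)%:R * modulus (delta (k%:R * h_ l) (h_ l))).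
have eps_cvg0 t : 0 < t -> eps t l @[l --> \oo] --> (0 : R).
  move=> t0; rewrite -(mulr0 2); apply: cvgM; first exact: cvg_cst.
  exact: delta_cvg0.
have cDR : continuous DR.
  by move=> t; apply: cvgB; [exact: continuous_ReLn|exact: continuous_Re_LS_sin].
have cDI : continuous DI.
  by move=> t; apply: cvgB; [exact: continuous_ImLn|exact: continuous_Im_LS_sin].
have zero t : 0 < t -> DR t = 0.
  apply: (vanishing_limit h_gt0 h_cvg0 cDR eps_cvg0) => {}t l t0.
  apply: le_trans (second_difference_even_bound _ DR0 (DRN _)) _.
  rewrite ler_wpM2l// ler_sum// => k _; rewrite ler_wpM2l//.
  by rewrite dR ?mulr_ge0 ?(ltW (h_gt0 l))// Re_le_modulus.
have linear t : 0 < t -> DI t = t * DI 1.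
  apply: (linear_limit h_gt0 h_cvg0 cDI eps_cvg0) => {}t l t0; cbv zeta.
  apply: le_trans (second_difference_bound _ _ DI0) _.
  rewrite ler_wpM2l// ler_sum// => k _; rewrite ler_wpM2l//.
  by rewrite dI ?mulr_ge0 ?(ltW (h_gt0 l))// Im_le_modulus.
have DI1 : DI 1 = Arg f 1 by rewrite /DI /E Im_LS_sin1 subr0.
have pos t : 0 < t -> f t = expC (0 +i* (t * Arg f 1) + E t).
  move=> t0; rewrite (expC_Ln f_continuous f_0 f_neq0); congr expC.
  have h1 := zero _ t0; have h2 := linear _ t0; rewrite DI1 in h2.
  apply: complexP; rewrite ?Re_add ?Im_add /=.
    by move/eqP : h1; rewrite subr_eq0 add0r => /eqP.
  by move/eqP : h2; rewrite subr_eq => /eqP.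
move=> t; have [t0|t0|->] := ltgtP t 0.
- rewrite -[t]opprK f_conj pos ?oppr_gt0// -expC_conj opprK; congr expC.
  rewrite /E LS_sinN; case: (LS_integral G (sin_integrand t)) => a b.
  by apply: complexP => /=; ring.
- exact: pos.
- by rewrite f_0 mul0r LS_sin0 addr0 expC0.
Qed.
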